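(* Let $\mathbf Q=(Q_1,Q_2,\dots)$ be an exponential structure with denominator sequence $(M(1),M(2),\dots)$ and let $I\subseteq\mathbb P$. Then, as formal power series, $$\sum_{i\in I}\mu_I(i)\frac{x^i}{M(i)\,i!}=-\ln\Big(\sum_{n\ge0}\frac{x^n}{M(n)\,n!}-\sum_{n\in\mathbb P\setminus I}m_n\frac{x^n}{M(n)\,n!}\Big).$$
   Context: $\mathbb P$ is the set of positive integers; convention $M(0)=1$. Partition lattice $\Pi_n$: set partitions of $\{1,\dots,n\}$ ordered by refinement. Exponential structure: a sequence $\mathbf Q=(Q_1,Q_2,\dots)$ of finite posets such that (E1) $Q_n$ has a unique maximal element $\hat1$ and every maximal chain of $Q_n$ has $n$ elements; (E2) for $x\in Q_n$ of rank $k$, $[x,\hat1]\cong\Pi_{n-k}$; (E3) the lower order ideal generated by $x\in Q_n$ is isomorphic to $Q_1^{a_1}\times\cdots\times Q_n^{a_n}$ for some nonnegative integers $(a_1,\dots,a_n)$, the type of $x$; (E4) $M(n)$ is the number of minimal elements of $Q_n$. Restricted poset: $Q_n^I$ is the subposet of $Q_n$ of elements whose type $(a_1,\dots,a_n)$ satisfies: $a_i>0$ implies $i\in I$. For $n\in I$, $\mu_I(n)$ is the Möbius function $\mu(\hat0,\hat1)$ of the poset $Q_n^I\cup\{\hat0\}$ ($\hat0$ a newly adjoined minimum); for $n\notin I$, $\mu_I(n)=0$. For every positive integer $n$, $m_n=1+\sum_{x\in Q_n^I}\mu(\hat0,x)$, with $\mu$ computed in $Q_n^I\cup\{\hat0\}$.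 *)

(* Defs.v *)
From HB Require Import structures.
From mathcomp Require Import boolp classical_sets.
From mathcomp Require Import all_boot all_order all_algebra.

Set Implicit Arguments.
Unset Strict Implicit.
Unset Printing Implicit Defensive.

Import Order.TTheory GRing.Theory Num.Theory.

(** * Finite posets *)

Definition poset_iso d d' (T : finPOrderType d) (U : finPOrderType d') : Prop :=
  exists f : T -> U, bijective f /\ {mono f : x y / (x <= y)%O}.

Section FinitePoset.
Context {d : Order.disp_t} {T : finPOrderType d}.
Implicit Types (x y : T) (C : {set T}).

Definition maximal x : bool := [forall y, (x <= y)%O ==> (y == x)].

Definition minimal x : bool := [forall y, (y <= x)%O ==> (y == x)].

Definition chain C : bool := [forall x in C, forall y in C, (x >=< y)%O].

Definition maximal_chain C : bool := maxset chain C.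

(* In a poset all of whose maximal chains have the same size, this is the usual
   rank function: minimal elements have rank 0. *)
Definition rank x : nat :=
  (\max_(C : {set T} | chain C && [forall y in C, (y <= x)%O]) #|C|).-1.

(* [mobius x y] is 0 unless x <= y, and satisfies [mobius_refl] and
   [mobius_lt] below; the fuel [#|T|] bounds the length of the recursion. *)
Fixpoint mobius_rec (k : nat) x y : int :=
  if k is k'.+1 then
    if x == y then 1%R else
    if (x < y)%O then (- \sum_(z | (x <= z < y)%O) mobius_rec k' x z)%R else 0%R
  else 0%R.

Definition mobius x y : int := mobius_rec #|T| x y.

Lemma mobius_rec_fuel k l x y : #|[set z | (z <= y)%O]| <= k ->
  #|[set z | (z <= y)%O]| <= l -> mobius_rec k x y = mobius_rec l x y.
Proof.
have pos : forall z : T, 0 < #|[set t | (t <= z)%O]|.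
  by move=> z; apply/card_gt0P; exists z; rewrite inE.
elim: k l y => [|k IH] [|l] y hk hl //.
- by move: (leq_trans (pos y) hk).
- by move: (leq_trans (pos y) hl).
rewrite /=; case: eqP => // _; case: ifP => // _; congr (- _)%R.
apply: eq_bigr => z /andP[_ zy].
have sub : #|[set t | (t <= z)%O]| < #|[set t | (t <= y)%O]|.
  apply: proper_card; apply/properP; split.
    by apply/subsetP=> t; rewrite !inE => /le_trans; apply; apply: ltW.
  by exists y; rewrite !inE ?lexx // lt_geF.
by apply: IH; rewrite -ltnS; [apply: leq_trans hk | apply: leq_trans hl].
Qed.

Lemma mobius_refl x : mobius x x = 1%R.
Proof.
rewrite /mobius; case: {-1}#|T| (erefl #|T|) => [/card0_eq/(_ x)//|k _].
by rewrite /= eqxx.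
Qed.

Lemma mobius_lt x y : (x < y)%O ->
  mobius x y = (- \sum_(z | (x <= z < y)%O) mobius x z)%R.
Proof.
move=> xy; have -> : mobius x y = mobius_rec #|T|.+1 x y.
  by apply: mobius_rec_fuel; [exact: max_card | apply/leqW; exact: max_card].
by rewrite /= lt_eqF ?xy.
Qed.

End FinitePoset.

(** * Subposets, products, and adjunction of a minimum *)

Section Subposet.
Context {d : Order.disp_t} {T : finPOrderType d}.

Definition subposet (P : pred T) : Type := {x : T | P x}.

HB.instance Definition _ (P : pred T) := SubFinite.on (subposet P).
HB.instance Definition _ (P : pred T) :=
  [SubChoice_isSubPOrder of subposet P by <: with d].

Definition lower_ideal (x : T) := subposet (fun y => (y <= x)%O).

Definition interval (x y : T) := subposet (fun z => (x <= z <= y)%O).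

End Subposet.

Section WithBot.
Context {d : Order.disp_t} (T : finPOrderType d).

(* [None] is the adjoined minimum. *)
Definition with_bot : Type := option T.

HB.instance Definition _ := Finite.on with_bot.

Definition with_bot_le (x y : with_bot) : bool :=
  match x, y with
  | None, _ => true
  | Some _, None => false
  | Some a, Some b => (a <= b)%O
  end.

Lemma with_bot_le_refl : reflexive with_bot_le.
Proof. by case=> //= a. Qed.

Lemma with_bot_le_anti : antisymmetric with_bot_le.
Proof. by move=> [a|] [b|] //= /le_anti ->. Qed.

Lemma with_bot_le_trans : transitive with_bot_le.
Proof. by move=> [b|] [a|] [c|] //=; apply: le_trans. Qed.

HB.instance Definition _ := Order.Le_isPOrder.Build d with_bot
  with_bot_le_refl with_bot_le_anti with_bot_le_trans.

End WithBot.

Section ProductPoset.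
Context {d : Order.disp_t} (J : finType) (P : J -> finPOrderType d).

Definition prod_poset : Type := {dffun forall j, P j}.

HB.instance Definition _ := Finite.on prod_poset.

Definition prod_le (f g : prod_poset) : bool := [forall j, (f j <= g j)%O].

Lemma prod_le_refl : reflexive prod_le.
Proof. by move=> f; apply/forallP=> j. Qed.

Lemma prod_le_anti : antisymmetric prod_le.
Proof.
move=> f g /andP[/forallP fg /forallP gf]; apply/ffunP=> j.
by apply: le_anti; rewrite fg gf.
Qed.

Lemma prod_le_trans : transitive prod_le.
Proof.
move=> g f h /forallP fg /forallP gh; apply/forallP=> j.
exact: le_trans (fg j) (gh j).
Qed.

HB.instance Definition _ := Order.Le_isPOrder.Build d prod_poset
  prod_le_refl prod_le_anti prod_le_trans.

End ProductPoset.

(** * The partition lattice *)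

Section PartitionLattice.
Variable n : nat.

Definition partition_lattice : Type :=
  {P : {set {set 'I_n}} | partition P [set: 'I_n]}.

HB.instance Definition _ := SubFinite.on partition_lattice.

Definition refines (P R : partition_lattice) : bool :=
  [forall B in val P, exists C in val R, B \subset C].

Lemma refinesP (P R : partition_lattice) :
  reflect (forall B, B \in val P -> exists2 C, C \in val R & B \subset C)
          (refines P R).
Proof.
apply: (iffP forall_inP) => h B /h; first by move/exists_inP.
by move=> [C CR BC]; apply/exists_inP; exists C.
Qed.

Lemma refines_refl : reflexive refines.
Proof. by move=> P; apply/refinesP => B BP; exists B. Qed.

Lemma refines_trans : transitive refines.
Proof.
move=> R P S /refinesP PR /refinesP RS; apply/refinesP => B /PR [C /RS [D DS CD] BC].
by exists D => //; apply: subset_trans CD.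
Qed.

Lemma refines_sub (P R : partition_lattice) : refines P R -> refines R P -> val P \subset val R.
Proof.
move=> /refinesP PR /refinesP RP; apply/subsetP => B BP.
have [C CR BC] := PR _ BP; have [D DP CD] := RP _ CR.
have /and3P[_ /trivIsetP tP P0] := valP P.
have BD : B = D.
  apply: contraNeq P0 => /(tP _ _ BP DP).
  rewrite -setI_eq0 (setIidPl (subset_trans BC CD)) => /eqP B0.
  by rewrite -B0.
suff -> : B = C by [].
by apply/eqP; rewrite eqEsubset BC BD CD.
Qed.

Lemma refines_anti : antisymmetric refines.
Proof.
move=> P R /andP[PR RP]; apply/val_inj/eqP.
by rewrite eqEsubset !refines_sub.
Qed.

Fact partition_display : Order.disp_t. Proof. exact: Order.Disp tt tt. Qed.

HB.instance Definition _ := Order.Le_isPOrder.Build partition_display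
  partition_lattice refines_refl refines_anti refines_trans.

End PartitionLattice.

(** * Exponential structures *)

Section ExponentialStructure.
Context {d : Order.disp_t} (Q : nat -> finPOrderType d).
(* Only the posets [Q n] with [0 < n] are meaningful; [Q 0] is arbitrary. *)

(* Q_1^{a_1} x ... x Q_n^{a_n}, where the ordinal i < n stands for the index
   i + 1; the factors are indexed by the pairs (i, j) with j < a_{i+1}. *)
Definition type_poset (n : nat) (a : 'I_n -> nat) :=
  prod_poset (fun j : {i : 'I_n & 'I_(a i)} => Q (tag j).+1).

Record exponential_structure : Prop := ExponentialStructure {
  exp_unique_maximal :
    forall n, 0 < n -> exists! t : Q n, maximal t;
  exp_maximal_chain :
    forall n, 0 < n -> forall C : {set Q n}, maximal_chain C -> #|C| = n;
  exp_upper_interval :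
    forall n, 0 < n -> forall x t : Q n, maximal t ->
      poset_iso (interval x t) (partition_lattice (n - rank x));
  exp_lower_ideal :
    forall n, 0 < n -> forall x : Q n,
      exists a : 'I_n -> nat, poset_iso (lower_ideal x) (type_poset a) }.

Definition denom (n : nat) : nat :=
  if n == 0 then 1 else #|[set x : Q n | minimal x]|.

(* As Q_1 is a single point, the isomorphism does not constrain a_1; the type
   of x is the vector normalized by sum_i i * a_i = n, as for the type of a set
   partition of an n-set. *)
Definition is_type (n : nat) (x : Q n) (a : 'I_n -> nat) : Prop :=
  poset_iso (lower_ideal x) (type_poset a) /\ \sum_(i < n) i.+1 * a i = n.

Variable I : set nat.

Definition in_restriction (n : nat) (x : Q n) : bool :=
  `[< exists2 a : 'I_n -> nat, is_type x a &
        forall i : 'I_n, 0 < a i -> i.+1 \in I >].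

Definition restricted (n : nat) := subposet (@in_restriction n).

Definition restricted_bot (n : nat) := with_bot (restricted n).

(* The maximum exists for n in I: it is the maximum of Q_n, of type e_n. *)
Definition mu_restricted (n : nat) : int :=
  if n \in I then
    if [pick t : restricted_bot n | [forall x, (x <= t)%O]] is Some t
    then mobius (None : restricted_bot n) t else 0%R
  else 0%R.

Definition m_restricted (n : nat) : int :=
  (1 + \sum_(x : restricted n) mobius (None : restricted_bot n) (Some x))%R.

End ExponentialStructure.

(** * Formal power series *)

Local Open Scope ring_scope.

(* The series sum_n (f n) x^n is represented by its coefficient sequence f. *)
Definition fps (R : Type) : Type := nat -> R.

Section Fps.
Variable R : fieldType.
Implicit Types f g : fps R.

Definition fps_one : fps R := fun n => (n == 0%N)%:R.

Definition fps_opp f : fps R := fun n => - f n.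

Definition fps_sub f g : fps R := fun n => f n - g n.

Definition fps_mul f g : fps R :=
  fun n => \sum_(i < n.+1) f i * g (n - i)%N.

Definition fps_exp f (k : nat) : fps R := iter k (fps_mul f) fps_one.

(* ln f = sum_(k >= 1) (-1)^(k+1) (f - 1)^k / k, for f with constant term 1;
   by [fps_exp_small] only the terms with k <= n contribute to x^n. *)
Definition fps_ln f : fps R := fun n =>
  \sum_(1 <= k < n.+1) (-1) ^+ k.+1 / k%:R * fps_exp (fps_sub f fps_one) k n.

Lemma fps_exp_small f k n : f 0%N = 0 -> (n < k)%N -> fps_exp f k n = 0.
Proof.
move=> f0; elim: k n => // k IH n nk; rewrite /= /fps_mul big1 // => i _.
case: (posnP i) => [->|i0]; first by rewrite f0 mul0r.
rewrite IH ?mulr0 //; apply: leq_trans (_ : (n <= k)%N) => //.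
by rewrite ltn_subrL i0 (leq_trans i0) // -ltnS.
Qed.

End Fps.

(* Main.v *)
Require Import Defs.
From mathcomp Require Import boolp classical_sets.
From mathcomp Require Import all_boot all_order all_algebra.
From mathcomp Require Import ring.

(** The type of [x] in [Q n] is read off the block sizes of the partition that
    [x] becomes in [[y, 1]], identified with the partition lattice, for any
    minimal [y <= x]. It does not depend on any choice, because it is determined by
    an invariant of the interval [[y, x]] that is additive on products: for
    [k > 1], the atoms of the interval lying below all but [2 ^ (k - 2)] of its
    coatoms are the pairs contained in a block of size [k].

    Hence the restricted poset below [x] is a product of restricted posets, and
    [w x = - mu(0, x)], characterized by [sum_(z <= x) w z = 1], is
    multiplicative: [w x] is the product of the [- mu_I(i)] over the factors
    [Q_i] of the lower ideal of [x]. Counting pairs of a minimal element [y] and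
    an element [x >= y], each with weight [w x] divided by the number of minimal
    elements below [x], gives [sum_x w x] as [M(n)] times the sum over the
    partitions of an [n]-set of the product of [- mu_I(|B|) / M(|B|)] over the
    blocks [B]. As [sum_x w x = 1 - m_n], and as [m_n = 0] for [n] in [I], the
    exponential formula concludes. *)

Set Implicit Arguments.
Unset Strict Implicit.
Unset Printing Implicit Defensive.

Import Order.TTheory GRing.Theory Num.Theory.
Local Open Scope ring_scope.

(** * Logarithms of formal power series *)

Section FpsLogarithm.
Variable F : fieldType.
Implicit Types (f g : fps F) (p q : {poly F}).

Definition trunc N f : {poly F} := \poly_(i < N) f i.

Lemma coef_trunc N f n : (n < N)%N -> (trunc N f)`_n = f n.
Proof. by move=> nN; rewrite coef_poly nN. Qed.

Lemma fps_exp_coef N f k n : (n < N)%N -> fps_exp f k n = (trunc N f ^+ k)`_n.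
Proof.
elim: k n => [|k IH] n nN; first by rewrite expr0 coef1.
rewrite exprS coefM /= /fps_mul; apply: eq_bigr => i _.
rewrite coef_trunc ?IH //; last by rewrite (leq_trans _ nN) // ltnS -ltnS.
by rewrite (leq_ltn_trans _ nN) // leq_subr.
Qed.

Lemma coef_expr_small p k n : p`_0 = 0 -> (n < k)%N -> (p ^+ k)`_n = 0.
Proof.
move=> p0 nk; have /factor_theorem[q ->] : root p 0.
  by rewrite /root horner_coef0 p0.
by rewrite subr0 exprMn coefMXn nk.
Qed.

(** A polynomial with constant term 1 is invertible modulo ['X^N]; here the coefficients of [q] are
    solved for one at a time. *)
Lemma coef_mul_unit_eq0 p q N : p`_0 = 1 ->
  (forall n, (n < N)%N -> (p * q)`_n = 0) -> forall n, (n < N)%N -> q`_n = 0.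
Proof.
move=> p0 pq n; elim/ltn_ind: n => n IH nN.
have := pq n nN; rewrite coefM big_ord_recl p0 mul1r subn0.
rewrite big1 ?addr0 // => i _; rewrite IH ?mulr0 //.
  by rewrite lift0 ltn_subrL /= (leq_ltn_trans _ (ltn_ord i)).
by rewrite (leq_ltn_trans _ nN) // leq_subr.
Qed.

(* The differential equation [f' = g' f] says [f = exp g]; differentiating the
   truncated logarithm of [f = 1 + p] gives [(1 + p) (ln f)' = p'] up to a
   multiple of [p ^ N], so both logarithmic derivatives agree. *)
Lemma fps_ln_unique f g : (forall n, (n.+1)%:R != 0 :> F) -> f 0%N = 1 ->
  (forall n, f n.+1 *+ n.+1 = \sum_(i < n.+1) (g i.+1 *+ i.+1) * f (n - i)%N) ->
  forall n, (0 < n)%N -> fps_ln f n = g n.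
Proof.
move=> char0 f0 fg [//|n] _.
pose p := trunc n.+2 (fps_sub f (fps_one F)).
have p0 : p`_0 = 0 by rewrite coef_trunc // /fps_sub /fps_one f0 subrr.
pose L := \sum_(1 <= k < n.+2) ((-1) ^+ k.+1 / k%:R) *: p ^+ k.
have LE : L`_n.+1 = fps_ln f n.+1.
  rewrite /fps_ln coef_sum; apply: eq_bigr => k _.
  by rewrite coefZ (fps_exp_coef _ _ (ltnSn _)).
(* Differentiating cancels the denominators and leaves the derivative of [p] times a geometric sum
   in [- p], which the factor [1 + p] telescopes. *)
have dL : (1 + p) * L^`() = p^`() * (1 - (- p) ^+ n.+1).
  rewrite raddf_sum /=.
  have -> : \sum_(1 <= k < n.+2) (((-1) ^+ k.+1 / k%:R) *: p ^+ k)^`()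
       = p^`() * \sum_(k < n.+1) (- p) ^+ k.
    rewrite big_add1 /= big_mkord mulr_sumr; apply: eq_bigr => k _.
    rewrite derivZ deriv_exp -scaler_nat scalerA -mulrA mulVf // mulr1 /=.
    rewrite exprSr exprSr mulrN1 mulrN1 opprK -mul_polyC polyC_exp polyCN polyC1.
    by rewrite [(- p) ^+ k]exprNn; ring.
  by have := subrX1 (- p) n.+1 => /(congr1 -%R); rewrite !opprB => ->; ring.
pose G := trunc n.+2 g.
(* Coefficient by coefficient, this is the hypothesis [fg] with [f] written as [1 + p]. *)
have dG k : (k < n.+1)%N -> ((1 + p) * G^`() - p^`())`_k = 0.
  move=> kn; rewrite coefB coef_deriv coef_trunc // /fps_sub /fps_one subr0 fg.
  rewrite mulrC coefM; apply/eqP; rewrite subr_eq0; apply/eqP.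
  apply: eq_bigr => i _; rewrite coef_deriv coef_trunc; last first.
    by rewrite ltnS (leq_trans _ kn).
  congr (_ * _); rewrite coefD coef1 coef_trunc.
    by rewrite /fps_sub /fps_one addrC subrK.
  by rewrite (leq_ltn_trans (leq_subr _ _)) // ltnW.
have LG k : (k < n.+1)%N -> (L^`() - G^`())`_k = 0.
  move: k; apply: (@coef_mul_unit_eq0 (1 + p)).
    by rewrite coefD coef1 p0 addr0.
  move=> k kn; rewrite mulrBr dL mulrBr mulr1 -addrA coefD addrC.
  rewrite coefD.
  have small : (p^`() * (- p) ^+ n.+1)`_k = 0.
    rewrite coefM big1 // => i _.
    rewrite (@coef_expr_small (- p)) ?mulr0 //.
      by rewrite coefN p0 oppr0.
    by rewrite (leq_ltn_trans (leq_subr _ _)).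
  rewrite 2!coefN small oppr0 addr0; apply/eqP.
  by move/eqP: (dG k kn); rewrite coefB subr_eq0 => /eqP ->; rewrite subrr.
have := LG n (ltnSn n); rewrite coefB !coef_deriv LE coef_trunc // -mulrnBl.
move/eqP; rewrite -mulr_natr mulf_eq0 (negPf (char0 n)) orbF subr_eq0.
by move/eqP.
Qed.

End FpsLogarithm.

(** * Sums over set partitions *)

Section PartitionSum.
Variables (R : comNzRingType) (g : nat -> R).

Definition partition_sum (T : finType) (D : {set T}) : R :=
  \sum_(P : {set {set T}} | partition P D) \prod_(B in P) g #|B|.

Lemma partition_setU1 (T : finType) (B D : {set T}) (P : {set {set T}}) :
  B != set0 -> B \subset D -> partition P (D :\: B) -> partition (B |: P) D.
Proof.
move=> B0 BD /and3P[/eqP cP tP P0]; have disj C : C \in P -> [disjoint B & C].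
  move=> CP; have CD : C \subset D :\: B by rewrite -cP (bigcup_max C).
  by rewrite disjoint_sym; move: CD; rewrite subsetD => /andP[].
apply/and3P; split.
- by rewrite /cover bigcup_setU big_set1 -/(cover P) cP -{1}(setIidPr BD) setID.
- apply/trivIsetP => C C'; rewrite !inE => /orP[/eqP->|CP] /orP[/eqP->|CP'] neq.
  + by rewrite eqxx in neq.
  + exact: disj.
  + by rewrite disjoint_sym disj.
  + exact: (trivIsetP tP).
- by rewrite !inE negb_or eq_sym B0.
Qed.

(** The partitions are classified by the block containing [x], of which [C] is the rest; the other
    blocks partition what remains of [D]. *)
Lemma partition_sum_rec (T : finType) (D : {set T}) x : x \in D ->
  partition_sum D = \sum_(C : {set T} | C \subset D :\ x)
                      g #|C|.+1 * partition_sum ((D :\ x) :\: C).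
Proof.
move=> xD; have xcover P : partition P D -> x \in cover P by case/and3P=> /eqP->.
rewrite /partition_sum (partition_big (fun P => pblock P x :\ x)
    (fun C => C \subset D :\ x)); last first.
  move=> P PD; apply: setSD; case/and3P: (PD) => /eqP <- _ _.
  by rewrite (bigcup_max (pblock P x)) ?pblock_mem ?xcover.
apply: eq_bigr => C CD; rewrite mulr_sumr.
have xC : x \notin C by apply/negP => /(subsetP CD); rewrite !inE eqxx.
have DxC : D :\ x :\: C = D :\: (x |: C) by rewrite setDDl.
rewrite (reindex_onto (fun P => (x |: C) |: P) (fun P => P :\ (x |: C))); last first.
  move=> P /andP[PD /eqP <-]; rewrite (setD1K (a := x)) ?mem_pblock ?xcover //.
  by rewrite setD1K // pblock_mem ?xcover.
have notin P : partition P (D :\ x :\: C) -> x |: C \notin P.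
  case/and3P=> /eqP cP _ _; apply/negP => xP.
  have /bigcupP : exists2 B, B \in P & x \in B by exists (x |: C); rewrite // !inE eqxx.
  by rewrite -/(cover P) cP !inE eqxx andbF.
apply: eq_big => P; last first.
  move=> /andP[_ /eqP PE]; have xP : x |: C \notin P by rewrite -PE !inE eqxx.
  by rewrite big_setU1 // cardsU1 xC.
apply/idP/idP => [/andP[/andP[PD _] /eqP <-]|PD].
  by rewrite DxC partitionD1 // !inE eqxx.
have x0 : x |: C != set0 by apply/set0Pn; exists x; rewrite !inE eqxx.
have PD' : partition (x |: C |: P) D.
  apply: partition_setU1; rewrite ?DxC // in PD *.
  by rewrite subUset sub1set xD (subset_trans CD) ?subD1set.
rewrite PD' setU1K ?notin // eqxx andbT /= (def_pblock (B := x |: C)).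
- by rewrite setU1K.
- by case/and3P: PD'.
- by rewrite !inE eqxx.
- by rewrite !inE eqxx.
Qed.

Lemma sum_subsets_card (T : finType) (E : {set T}) (F : nat -> R) :
  \sum_(C : {set T} | C \subset E) F #|C| = \sum_(i < #|E|.+1) F i *+ 'C(#|E|, i).
Proof.
rewrite (partition_big (fun C : {set T} => inord #|C| : 'I_(#|E|.+1)) predT) //.
apply: eq_bigr => i _; rewrite -cards_draws -sumr_const.
have cardE (C : {set T}) : C \subset E -> (inord #|C| == i :> 'I_(#|E|.+1)) = (#|C| == i).
  by move=> CE; rewrite -val_eqE /= inordK // ltnS subset_leq_card.
apply: eq_big => [C|C /andP[CE]]; last by rewrite cardE // => /eqP->.
by rewrite inE; case: (boolP (C \subset E)) => // /cardE ->.
Qed.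

(** The complete Bell polynomial evaluated at [g 1], ..., [g n]. *)
Definition partition_number n := partition_sum [set: 'I_n].

(** Instead of transporting partitions along a bijection, induction on [#|D|] uses that the
    recursion on the block of a chosen point involves [D] only through its cardinality. *)
Lemma partition_sum_card (T : finType) (D : {set T}) :
  partition_sum D = partition_number #|D|.
Proof.
have [m] := ubnP #|D|; elim: m => // m IH in T D *.
case: (set_0Vmem D) => [->|[x xD]].
  rewrite /partition_number /partition_sum cards0 => _.
  have E (U : finType) (E : {set U}) : #|E| = 0%N ->
      \sum_(P : {set {set U}} | partition P E) \prod_(B in P) g #|B| = 1.
    move=> /cards0_eq->; rewrite (big_pred1 set0) ?big_set0 // => P.
    by rewrite partition_set0.
  by rewrite !E ?cards0 // cardsT card_ord.
have IH' (U : finType) (E : {set U}) y : (#|E| <= m)%N -> y \in E -> partition_sum E =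
    \sum_(i < #|E|.-1.+1) (g i.+1 * partition_number (#|E|.-1 - i)) *+ 'C(#|E|.-1, i).
  move=> Em yE; rewrite (partition_sum_rec yE).
  have cE : #|E :\ y| = #|E|.-1 by rewrite [#|E| in RHS](cardsD1 y) yE.
  rewrite -cE -(sum_subsets_card _ (fun i => g i.+1 * partition_number (#|E :\ y| - i))).
  apply: eq_bigr => C CE; rewrite IH; first by rewrite cardsD (setIidPr CE).
  rewrite (leq_trans _ Em) // (leq_ltn_trans (subset_leq_card (subsetDl _ _))) //.
  by rewrite [X in (_ < X)%N](cardsD1 y) yE.
rewrite ltnS => Dm; rewrite (IH' _ _ x) // /partition_number.
have D0 : (0 < #|D|)%N by rewrite (cardD1 x) xD.
by rewrite (IH' _ _ (Ordinal D0)) ?inE // !cardsT !card_ord.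
Qed.

Lemma partition_number0 : partition_number 0 = 1.
Proof.
rewrite /partition_number /partition_sum (big_pred1 set0) ?big_set0 // => P.
have -> : [set: 'I_0] = set0 by apply/setP => -[].
by rewrite partition_set0.
Qed.

Lemma partition_numberS n : partition_number n.+1 =
  \sum_(i < n.+1) (g i.+1 * partition_number (n - i)) *+ 'C(n, i).
Proof.
rewrite {1}/partition_number (partition_sum_rec (in_setT ord0)).
have cE : #|[set: 'I_n.+1] :\ ord0| = n by rewrite cardsDS ?subsetT // cardsT card_ord cards1 subn1.
rewrite -[in RHS]cE.
rewrite -(sum_subsets_card _ (fun i => g i.+1 * partition_number (#|[set: 'I_n.+1] :\ ord0| - i))).
by apply: eq_bigr => C CE; rewrite partition_sum_card cardsD (setIidPr CE).
Qed.

End PartitionSum.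

(** The exponential formula: dividing [partition_numberS] by the factorial of [n] turns its binomial
    convolution into the recurrence required by [fps_ln_unique]. *)
Lemma fps_ln_partition_number (g : nat -> rat) n : (0 < n)%N ->
  fps_ln (fun m => partition_number g m / m`!%:R) n = g n / n`!%:R.
Proof.
move: n; apply: (@fps_ln_unique _ _ (fun i => g i / i`!%:R)).
- by move=> n; rewrite pnatr_eq0.
- by rewrite partition_number0 fact0 divr1.
have fact0 m : m`!%:R != 0 :> rat by rewrite pnatr_eq0 -lt0n fact_gt0.
have divS (a : rat) m : a / m.+1`!%:R *+ m.+1 = a / m`!%:R.
  rewrite factS natrM invfM -mulr_natr mulrA mulrAC divfK //.
  by rewrite pnatr_eq0.
move=> n; rewrite divS partition_numberS mulr_suml; apply: eq_bigr => i _.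
rewrite divS -mulr_natr -(bin_fact (leq_ord i)) !natrM.
have binN0 : 'C(n, i)%:R != 0 :> rat by rewrite pnatr_eq0 -lt0n bin_gt0 leq_ord.
by field; rewrite !fact0 binN0.
Qed.

(** * An additive invariant of intervals *)

Section AtomCount.
Context {d : Order.disp_t} {T : finPOrderType d}.
Implicit Types y z p c : T.

Definition covered y p : bool :=
  (y < p)%O && [forall t, (y <= t <= p)%O ==> (t == y) || (t == p)].

(** Counting the coatoms that are not above [p] makes the invariant local: for an atom [p] of a
    product interval, a coatom that moves another coordinate than [p] does lies above [p], so only
    one factor matters. *)
Definition avoiding_coatoms y z p : {set T} :=
  [set c | [&& (y <= c)%O, covered c z & ~~ (p <= c)%O]].

Definition atoms_avoided y z K : {set T} :=
  [set p | [&& covered y p, (p <= z)%O & #|avoiding_coatoms y z p| == K]].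

Lemma coveredP y p :
  reflect ((y < p)%O /\ forall t, (y <= t <= p)%O -> t = y \/ t = p) (covered y p).
Proof.
apply: (iffP andP) => -[yp H]; split=> //.
  by move=> t /(implyP (forallP H t))/orP[]/eqP; [left | right].
by apply/forallP => t; apply/implyP => /H[->|->]; rewrite eqxx ?orbT.
Qed.

End AtomCount.

(** * Invariance under convex embeddings *)

Section ConvexEmbedding.
Context {d d' : Order.disp_t} {T : finPOrderType d} {U : finPOrderType d'}.
Variables (f : T -> U) (y z : T).
Hypothesis fle : {mono f : x x' / (x <= x')%O}.
Hypothesis fconvex : forall u, (f y <= u <= f z)%O -> exists x, f x = u.

Let finj : injective f.
Proof. exact: inc_inj. Qed.

Lemma covered_embed a b : (y <= a)%O -> (b <= z)%O ->
  covered (f a) (f b) = covered a b.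
Proof.
move=> ya bz; apply/coveredP/coveredP => -[ab H]; split.
- by rewrite -(leW_mono fle).
- by move=> t; rewrite -!fle => /H[]/finj; [left | right].
- by rewrite (leW_mono fle).
move=> u /andP[au ub]; have [|t tu] := fconvex (u := u).
  by rewrite (le_trans _ au) ?fle // (le_trans ub) ?fle.
by move: au ub; rewrite -tu !fle => at_ tb; case: (H t) => [|->|->]; rewrite ?at_; auto.
Qed.

Lemma avoiding_coatoms_embed p :
  avoiding_coatoms (f y) (f z) (f p) = f @: avoiding_coatoms y z p.
Proof.
apply/setP => u; rewrite !inE; apply/idP/imsetP.
  move=> /and3P[yu uz pu]; have [|c cu] := fconvex (u := u).
    by rewrite yu; case/coveredP: uz => /ltW ->.
  subst u; exists c => //; rewrite fle in yu.
  by rewrite inE yu -covered_embed // uz -fle.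
by move=> [c]; rewrite inE => /and3P[yc cz pc] ->; rewrite !fle yc covered_embed ?cz.
Qed.

(** Covers, atoms and coatoms of an interval are determined inside it, and [fconvex] makes [f] an
    isomorphism from [[y, z]] onto [[f y, f z]]. *)
Lemma card_atoms_avoided_embed K :
  #|atoms_avoided (f y) (f z) K| = #|atoms_avoided y z K|.
Proof.
rewrite -(card_imset _ finj); apply: eq_card => u; rewrite !inE; apply/idP/imsetP.
  move=> /and3P[yu uz pu]; have [|p pE] := fconvex (u := u).
    by rewrite uz; case/coveredP: yu => /ltW ->.
  subst u; exists p => //; rewrite fle in uz.
  rewrite inE -covered_embed // yu uz /=.
  by rewrite avoiding_coatoms_embed card_imset in pu.
move=> [p]; rewrite inE => /and3P[yp pz pK] ->.
by rewrite fle covered_embed // yp pz avoiding_coatoms_embed card_imset.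
Qed.

End ConvexEmbedding.

(** * Additivity over products *)

Section ProductAtoms.
Context {d : Order.disp_t} {J : finType} {P : J -> finPOrderType d}.
Implicit Types g h : prod_poset P.

Definition replace g (j : J) (q : P j) : prod_poset P :=
  [ffun i => dfwith (fun i => g i) q i].

Lemma prod_leP g h : reflect (forall j, (g j <= h j)%O) (g <= h)%O.
Proof. exact: forallP. Qed.

Lemma replace_in g j (q : P j) : replace g q j = q.
Proof. by rewrite ffunE dfwith_in. Qed.

Lemma replace_out g j (q : P j) i : j != i -> replace g q i = g i.
Proof. by move=> ji; rewrite ffunE dfwith_out. Qed.

Lemma prod_posetP g h : (forall j, g j = h j) -> g = h.
Proof. by move=> gh; apply/ffunP => j; apply: gh. Qed.

Lemma replace_inj g j : injective (@replace g j).
Proof. by move=> q q' /(congr1 (fun h : prod_poset P => h j)); rewrite !replace_in. Qed.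

Lemma le_replace g h j (q : P j) : (forall i, j != i -> (h i <= g i)%O) ->
  (h <= replace g q)%O = (h j <= q)%O.
Proof.
move=> hg; apply/prod_leP/idP => [/(_ j)|hq i]; first by rewrite replace_in.
by have [<-|ji] := eqVneq j i; rewrite ?replace_in ?replace_out ?hg.
Qed.

Lemma replace_le g h j (q : P j) : (forall i, j != i -> (g i <= h i)%O) ->
  (replace g q <= h)%O = (q <= h j)%O.
Proof.
move=> hg; apply/prod_leP/idP => [/(_ j)|hq i]; first by rewrite replace_in.
by have [<-|ji] := eqVneq j i; rewrite ?replace_in ?replace_out ?hg.
Qed.

Lemma replace_eq g h j : (forall i, j != i -> h i = g i) -> h = replace g (h j).
Proof.
move=> hg; apply: prod_posetP => i.
by have [<-|ji] := eqVneq j i; [rewrite replace_in | rewrite replace_out ?hg].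
Qed.

Lemma replace_id g j : replace g (g j) = g.
Proof. by rewrite -replace_eq. Qed.

Lemma prod_neq g h : g <> h -> exists j, g j <> h j.
Proof.
move=> gh; have [/forallP E|/forallPn[j /eqP]] := boolP [forall j, g j == h j].
  by case: gh; apply: prod_posetP => j; apply/eqP.
by exists j.
Qed.

(** Whatever lies between [g] and [replace g q] agrees with [g] off [j]. *)
Lemma covered_replace_up g j (q : P j) :
  covered g (replace g q) = covered (g j) q.
Proof.
apply/coveredP/coveredP => -[gq H]; split.
- by rewrite lt_def -(le_replace (g := g)) // (ltW gq) andbT; apply: contraTneq gq => ->;
    rewrite replace_id ltxx.
- move=> t /andP[gt tq].
  have /H[] : (g <= replace g t <= replace g q)%O.
    by rewrite le_replace // gt le_replace ?replace_in // => i ji; rewrite replace_out.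
  + by rewrite -[in X in _ = X](replace_id g j) => /replace_inj; left.
  + by move/replace_inj; right.
- rewrite lt_def le_replace // (ltW gq) andbT; apply: contraTneq gq.
  by rewrite -[in X in _ = X](replace_id g j) => /replace_inj ->; rewrite ltxx.
move=> h /andP[gh hq].
have hE : h = replace g (h j).
  apply: replace_eq => i ji; apply: le_anti; rewrite (prod_leP _ _ gh) andbT.
  by have := prod_leP _ _ hq i; rewrite replace_out.
rewrite hE; case: (H (h j)) => [|->|->]; rewrite ?replace_id; auto.
by rewrite (prod_leP _ _ gh) -[X in (_ <= X)%O](replace_in g) (prod_leP _ _ hq).
Qed.

Lemma covered_replace_down g j (q : P j) :
  covered (replace g q) g = covered q (g j).
Proof.
have E : g = replace (replace g q) (g j).
  by apply: replace_eq => i ji; rewrite replace_out.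
by rewrite [X in covered _ X]E covered_replace_up replace_in.
Qed.

(** Changing [g] at one coordinate where it differs from [h] gives an element between them other
    than [g], which must then be [h]. *)
Lemma covered_prodP g h : covered g h -> exists j, h = replace g (h j).
Proof.
move=> /coveredP[gh H]; have [j gj] : exists j, g j <> h j.
  by apply: prod_neq => E; rewrite E ltxx in gh.
exists j; have := H (replace g (h j)); have le := prod_leP _ _ (ltW gh).
rewrite le_replace // replace_le // le lexx => /(_ isT)[] // E.
by case: gj; rewrite -[in LHS]E replace_in.
Qed.

Lemma covered_prod_downP g h : covered g h -> exists j, g = replace h (g j).
Proof.
move=> /covered_prodP[j E]; exists j; apply: replace_eq => i ji.
by rewrite E replace_out.
Qed.

(** A coatom moves a single coordinate of [h]. If this is not [j], the coatom equals [h] at [j] and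
    is above [g] elsewhere, so it is above [replace g q]. *)
Lemma card_avoiding_coatoms_replace g h j (q : P j) : (g <= h)%O -> (q <= h j)%O ->
  #|avoiding_coatoms g h (replace g q)| = #|avoiding_coatoms (g j) (h j) q|.
Proof.
move=> gh qh; rewrite -(card_imset _ (@replace_inj h j)).
apply: eq_card => c; have le := prod_leP _ _ gh.
apply/idP/imsetP => [|[c' + ->]]; rewrite !inE; last first.
  move=> /and3P[gc ch qc]; rewrite le_replace // gc covered_replace_down ch /=.
  by rewrite le_replace ?replace_in // => i ji; rewrite replace_out.
move=> /and3P[gc ch qc]; have [i cE] := covered_prod_downP ch.
have ij : i = j.
  apply: contraNeq qc => ij; apply/prod_leP => k; rewrite cE.
  have [<-{k}|jk] := eqVneq j k.
    by rewrite replace_in replace_out.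
  rewrite replace_out //; have [<-|ik] := eqVneq i k.
    by rewrite replace_in (prod_leP _ _ gc).
  by rewrite replace_out.
subst i; exists (c j) => //; rewrite inE.
rewrite (prod_leP _ _ gc) -covered_replace_down -cE ch /=.
by rewrite -(@replace_le g c) // => i _; apply: (prod_leP _ _ gc).
Qed.

(** An atom moves a single coordinate of [g], so the atoms form the disjoint union of those of the
    factors, encoded by the tagged set [A]. *)
Lemma card_atoms_avoided_prod g h K : (g <= h)%O ->
  #|atoms_avoided g h K| = (\sum_j #|atoms_avoided (g j) (h j) K|)%N.
Proof.
move=> gh; have le := prod_leP _ _ gh.
pose A := [set u : {j : J & P j} | tagged u \in atoms_avoided (g (tag u)) (h (tag u)) K].
have -> : (\sum_j #|atoms_avoided (g j) (h j) K|)%N = #|A|.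
  rewrite -sum1_card; under eq_bigr do rewrite -sum1_card.
  by rewrite sig_big_dep; apply: eq_bigl => u; rewrite [in RHS]inE.
pose f (u : {j : J & P j}) := replace g (tagged u).
(* An atom is strictly above [g] at its own coordinate only, which recovers the tag. *)
rewrite -(@card_in_imset _ _ f A) => [|[i p] [j q]]; last first.
  rewrite /f !inE /= => /and3P[/coveredP[gp _] _ _] _.
  have [ij|ij] := eqVneq i j; first by subst j => /replace_inj ->.
  move=> /(congr1 (fun h : prod_poset P => h i)); rewrite replace_in replace_out.
    by move=> pE; rewrite pE ltxx in gp.
  by rewrite eq_sym.
apply: eq_card => p; apply/idP/imsetP => [|[[j q] + ->]]; rewrite !inE /f /=.
  move=> /and3P[gp ph pK]; have [j pE] := covered_prodP gp.
  exists (Tagged P (p j)) => //; rewrite !inE /= -covered_replace_up -pE gp.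
  have pj := prod_leP _ _ ph j.
  by rewrite pj -card_avoiding_coatoms_replace // -pE.
move=> /and3P[gq qh qK].
by rewrite covered_replace_up gq replace_le // qh card_avoiding_coatoms_replace.
Qed.

End ProductAtoms.

(** * The invariant in partition lattices *)

Section PartitionAtoms.
Variable n : nat.
Implicit Types (P R c p : partition_lattice n) (a b i j : 'I_n) (D S B : {set 'I_n}).

(** Partitions are handled as equivalence relations, for which refinement is inclusion
    ([le_partitionP]). *)
Definition same_block P i j : bool := j \in pblock (val P) i.

Lemma mem_cover P i : i \in cover (val P).
Proof. by have /and3P[/eqP -> _ _] := valP P; rewrite inE. Qed.

Lemma partition_triv P : trivIset (val P).
Proof. by have /and3P[] := valP P. Qed.

Lemma pblock_in P i : pblock (val P) i \in val P.
Proof. exact/pblock_mem/mem_cover. Qed.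

Lemma same_blockE P i j : same_block P i j = (pblock (val P) i == pblock (val P) j).
Proof. by rewrite eq_pblock ?partition_triv ?mem_cover. Qed.

Lemma same_block_refl P i : same_block P i i.
Proof. by rewrite same_blockE. Qed.

Lemma same_block_sym P i j : same_block P i j = same_block P j i.
Proof. by rewrite !same_blockE eq_sym. Qed.

Lemma same_block_trans P j i l : same_block P i j -> same_block P j l -> same_block P i l.
Proof. by rewrite !same_blockE => /eqP-> /eqP->. Qed.

Lemma pblockE P B i : B \in val P -> i \in B -> pblock (val P) i = B.
Proof. exact/def_pblock/partition_triv. Qed.

Lemma le_partitionP P R :
  reflect (forall i j, same_block P i j -> same_block R i j) (P <= R)%O.
Proof.
apply: (iffP (refinesP P R)) => [H i j ij|H B BP].
  have [C CR sub] := H _ (pblock_in P i).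
  have iC : i \in C by apply: (subsetP sub); rewrite mem_pblock mem_cover.
  by rewrite /same_block (pblockE CR iC) (subsetP sub).
have /and3P[_ _ P0] := valP P.
have /set0Pn[i iB] : B != set0 by apply: contraNneq P0 => <-.
exists (pblock (val R) i); first exact: pblock_in.
by apply/subsetP => j jB; apply: H; rewrite /same_block (pblockE BP iB).
Qed.

Definition kernel (rT : eqType) (f : 'I_n -> rT) : partition_lattice n :=
  Sub (preim_partition f setT) (preim_partitionP f setT).

Lemma same_block_kernel (rT : eqType) (f : 'I_n -> rT) i j :
  same_block (kernel f) i j = (f i == f j).
Proof.
rewrite /same_block SubK /preim_partition pblock_equivalence_partition ?inE //.
by split=> // /eqP->.
Qed.

Definition merge D : partition_lattice n :=
  kernel (fun i => if i \in D then None else Some i).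

Lemma same_block_merge D i j :
  same_block (merge D) i j = (i == j) || (i \in D) && (j \in D).
Proof.
rewrite same_block_kernel; have [->|ij] := eqVneq i j; first by rewrite eqxx.
case: (i \in D); case: (j \in D) => //=.
by apply/eqP => -[/eqP]; rewrite (negPf ij).
Qed.

Lemma same_block_merge2 a b : same_block (merge [set a; b]) a b.
Proof. by rewrite same_block_merge !inE !eqxx /= !orbT. Qed.

Lemma merge2_le P a b : (merge [set a; b] <= P)%O = same_block P a b.
Proof.
apply/le_partitionP/idP => [|ab i j].
  by apply; apply: same_block_merge2.
rewrite same_block_merge => /orP[/eqP->|]; first exact: same_block_refl.
by rewrite !inE => /andP[/orP[]/eqP-> /orP[]/eqP->];
  rewrite ?same_block_refl // same_block_sym.
Qed.

(** A pair is recovered from its merge as the set of points that share their block with another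
    point. *)
Lemma merge_inj : {in [pred D : {set 'I_n} | #|D| == 2] &, injective merge}.
Proof.
have mergeP (D : {set 'I_n}) : #|D| = 2 ->
    D = [set i | [exists j, (i != j) && same_block (merge D) i j]].
  move=> /eqP/cards2P[a [b [ab ->]]]; apply/setP => i; rewrite [in RHS]inE; apply/idP/existsP.
    rewrite !inE => /orP[]/eqP->; [exists b | exists a].
      by rewrite ab same_block_merge2.
    by rewrite eq_sym ab same_block_sym same_block_merge2.
  by move=> [j /andP[/negPf ij]]; rewrite same_block_merge ij => /andP[].
by move=> D D' /eqP/mergeP{2}-> /eqP/mergeP{2}-> ->.
Qed.

Variable bot : partition_lattice n.
Hypothesis bot_le : forall P, (bot <= P)%O.

Lemma same_block_bot i j : same_block bot i j = (i == j).
Proof.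
apply/idP/eqP => [ij|->]; last exact: same_block_refl.
have /le_partitionP/(_ i j ij) := bot_le (kernel id).
by rewrite same_block_kernel => /eqP.
Qed.

(** A partition strictly above the bottom joins some pair [a], [b], hence lies above their merge;
    being an atom, it is that merge. *)
Lemma covered_botP p :
  reflect (exists a b, a != b /\ p = merge [set a; b]) (covered bot p).
Proof.
apply: (iffP (coveredP _ _)) => [[bp H]|[a [b [ab ->]]]].
  have [a [b [ab pab]]] : exists a b, a != b /\ same_block p a b.
    have [/exists_inP[[a b] /= pab ab]|] :=
        boolP [exists x in [pred x : 'I_n * 'I_n | same_block p x.1 x.2], x.1 != x.2].
      by exists a, b.
    move=> /exists_inPn H'; suff : (p <= bot)%O by move=> /le_gtF; rewrite bp.
    apply/le_partitionP => i j pij; rewrite same_block_bot.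
    by have := H' (i, j) pij; rewrite negbK.
  exists a, b; split=> //.
  case: (H (merge [set a; b])) => //; first by rewrite bot_le merge2_le.
  move=> /(congr1 (fun P => same_block P a b)).
  by rewrite same_block_bot same_block_merge2 (negPf ab).
split.
  rewrite lt_def bot_le andbT; apply/eqP => /(congr1 (fun P => same_block P a b)).
  by rewrite same_block_bot same_block_merge2 (negPf ab).
move=> t /andP[_ tm]; have [tab|tab] := boolP (same_block t a b).
  by right; apply: le_anti; rewrite tm merge2_le.
left; apply: le_anti; rewrite bot_le andbT; apply/le_partitionP => i j ij.
rewrite same_block_bot; have := le_partitionP _ _ tm i j ij.
rewrite same_block_merge => /orP[//|]; rewrite !inE => /andP[/orP[]/eqP iE /orP[]/eqP jE];
  subst => //; first by rewrite ij in tab.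
by rewrite same_block_sym ij in tab.
Qed.

Variable P : partition_lattice n.

(** The common refinement of [P] and the partition into [S] and its complement; a nonempty proper
    part [S] of a block cuts that block in two. *)
Definition split_off S : partition_lattice n :=
  kernel (fun i => (i \in S, pblock (val P) i)).

Lemma same_block_split_off S i j :
  same_block (split_off S) i j = ((i \in S) == (j \in S)) && same_block P i j.
Proof. by rewrite same_block_kernel same_blockE. Qed.

(** The coatoms below [P] cut one block in two. Those that separate [a] from [b] cut their block
    [B], and are determined by the points put on the side of [a]: any subset of [B] without [a] and
    [b]. *)
Lemma card_avoiding_coatoms_merge a b : a != b -> same_block P a b ->
  #|avoiding_coatoms bot P (merge [set a; b])| = (2 ^ (#|pblock (val P) a| - 2))%N.
Proof.
move=> ab Pab; set B := pblock _ a.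
have aB : a \in B by rewrite /B mem_pblock mem_cover.
have bB : b \in B by [].
pose f S := split_off (a |: S).
have cardB : #|B :\: [set a; b]| = (#|B| - 2)%N.
  rewrite cardsD (setIidPr _) ?cards2 ?ab //.
  by apply/subsetP => i; rewrite !inE => /orP[]/eqP->.
rewrite -cardB -card_powerset -(@card_in_imset _ _ f); last first.
  have memf S i : S \subset B :\: [set a; b] ->
      (i \in S) = (i != a) && same_block (f S) a i.
    move=> /subsetP/(_ i); rewrite same_block_split_off !inE eqxx /= negb_or.
    case: (i \in S) => [/(_ isT)/andP[/andP[ia _] iB]|_]; first by rewrite ia orbT.
    by case: (i == a).
  move=> S S'; rewrite !inE => SB S'B E; apply/setP => i.
  by rewrite !memf ?E.
apply: eq_card => c; rewrite inE bot_le /= merge2_le; apply/andP/imsetP; last first.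
  move=> [S]; rewrite inE => SB ->.
  have bS : b \in a |: S = false.
    rewrite !inE [b == a]eq_sym (negPf ab).
    by apply/negP => /(subsetP SB); rewrite !inE eqxx orbT.
  have aS : a \in a |: S by rewrite !inE eqxx.
  have fab : same_block (f S) a b = false.
    by rewrite same_block_split_off aS bS.
  split; last by rewrite fab.
  have fP : (f S <= P)%O.
    by apply/le_partitionP => i j; rewrite same_block_split_off => /andP[].
  apply/coveredP; split.
    rewrite lt_def fP andbT; apply/eqP => /(congr1 (fun R => same_block R a b)).
    by rewrite Pab fab.
  have inB i : i \in a |: S -> i \in B.
    by rewrite !inE => /orP[/eqP->//|/(subsetP SB)]; rewrite !inE => /andP[].
  (* Between [f S] and [P], the partition [t] either joins the two halves of [B] and is [P], or
     keeps them apart and is [f S]. *)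
  move=> t /andP[ft tP].
  have [tab|tab] := boolP (same_block t a b).
    right; apply: le_anti; rewrite tP; apply/le_partitionP => i j Pij.
    have ta l : l \in B -> same_block t a l.
      move=> lB; have [lS|lS] := boolP (l \in a |: S).
        by apply: (le_partitionP _ _ ft); rewrite same_block_split_off lS aS.
      apply: same_block_trans tab _; apply: (le_partitionP _ _ ft).
      rewrite same_block_split_off (negPf lS) bS /=.
      by apply: same_block_trans lB; rewrite same_block_sym.
    have [iB|iB] := boolP (i \in B).
      apply: (@same_block_trans _ a); first by rewrite same_block_sym ta.
      by apply: ta; apply: same_block_trans Pij.
    have jB : j \notin B.
      apply: contra iB => jB; apply: (@same_block_trans _ j) => //.
      by rewrite same_block_sym.
    apply: (le_partitionP _ _ ft); rewrite same_block_split_off Pij andbT.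
    by rewrite (negPf (contra (@inB i) iB)) (negPf (contra (@inB j) jB)).
  left; apply: le_anti; rewrite ft andbT; apply/le_partitionP => i j tij.
  have Pij := le_partitionP _ _ tP _ _ tij.
  rewrite same_block_split_off Pij andbT; apply: contraR tab.
  (* By symmetry [i] is on the side of [a] and [j] on that of [b]; then [t] joins [a] to [b] through
     [i] and [j]. *)
  wlog iS : i j tij Pij / i \in a |: S => [H|].
    have [iS|iS] := boolP (i \in a |: S).
      by move=> neq; apply: (H i j) => //; rewrite iS.
    have [jS|jS] := boolP (j \in a |: S); last by [].
    by move=> _; apply: (H j i) => //; rewrite 1?same_block_sym // (negPf iS) jS.
  rewrite iS => jS; have {}jS : j \notin a |: S by case: (_ \in _) jS.
  have iB := inB _ iS.
  have jB : same_block P b j.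
    by apply: same_block_trans Pij; apply: same_block_trans iB; rewrite same_block_sym.
  apply: (@same_block_trans _ i); last apply: (same_block_trans tij).
    by apply: (le_partitionP _ _ ft); rewrite same_block_split_off iS aS.
  apply: (le_partitionP _ _ ft); rewrite same_block_split_off (negPf jS).
  by rewrite same_block_sym jB bS.
move=> [cP cab]; have /coveredP[/ltW cleP H] := cP.
pose S := pblock (val c) a :\ a.
have aS : a |: S = pblock (val c) a.
  by rewrite setD1K // mem_pblock mem_cover.
have memS i : (i \in a |: S) = same_block c a i by rewrite aS.
exists S; rewrite ?inE.
  apply/subsetP => i; rewrite !inE => /andP[ia ci].
  rewrite negb_or ia; apply/andP; split; last exact: (le_partitionP _ _ cleP).
  by apply: contra cab => /eqP <-.
(* [f S] lies between [c] and [P] and separates [a] from [b], so it is [c] and not [P]. *)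
have cf : (c <= f S)%O.
  apply/le_partitionP => i j ij; rewrite same_block_split_off (le_partitionP _ _ cleP) // andbT.
  rewrite !memS; apply/eqP; apply/idP/idP => h; first exact: same_block_trans ij.
  by apply: same_block_trans h _; rewrite same_block_sym.
have [|//|E] := H (f S).
  by rewrite cf; apply/le_partitionP => i j; rewrite same_block_split_off => /andP[].
have := congr1 (fun R => same_block R a b) E.
by rewrite Pab same_block_split_off !memS same_block_refl (negPf cab).
Qed.

Definition nblocks k := #|[set B in val P | #|B| == k]|.

(** Each block of size [k] contains ['C(k, 2)] pairs, one for each atom. The bound [1 < k] lets
    [2 ^ (k - 2)] determine [k]: truncated subtraction gives the same value for all [k <= 2]. *)
Lemma card_atoms_avoided_partition k : (1 < k)%N ->
  #|atoms_avoided bot P (2 ^ (k - 2))%N| = (nblocks k * 'C(k, 2))%N.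
Proof.
move=> k1.
pose A := [set u : {set 'I_n} * {set 'I_n} |
  [&& u.1 \in val P, #|u.1| == k, u.2 \subset u.1 & #|u.2| == 2]].
have <- : #|A| = (nblocks k * 'C(k, 2))%N.
  rewrite /nblocks -sum_nat_const -sum1_card.
  transitivity (\sum_(B in [set B in val P | #|B| == k])
      \sum_(D : {set 'I_n} | (D \subset B) && (#|D| == 2)) 1)%N.
    by rewrite pair_big_dep; apply: eq_bigl => u; rewrite !inE andbA.
  apply: eq_bigr => B; rewrite inE => /andP[_ /eqP <-].
  by rewrite -cards_draws -sum1_card; apply: eq_bigl => D; rewrite inE.
rewrite -(@card_in_imset _ _ (fun u => merge u.2) A); last first.
  move=> [B D] [B' D']; rewrite !inE /= => /and4P[BP _ DB D2] /and4P[B'P _ DB' D2'].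
  move=> /(merge_inj D2 D2') E; subst D'.
  have /set0Pn[i iD] : D != set0 by rewrite -cards_eq0 (eqP D2).
  by rewrite -(pblockE BP (subsetP DB i iD)) -(pblockE B'P (subsetP DB' i iD)).
have pow a b : a != b -> same_block P a b ->
    (2 ^ (#|pblock (val P) a| - 2) == 2 ^ (k - 2))%N = (#|pblock (val P) a| == k).
  move=> ab Pab; rewrite eqn_exp2l //.
  have B2 : (1 < #|pblock (val P) a|)%N.
    have /subset_leq_card : [set a; b] \subset pblock (val P) a.
      by apply/subsetP => i; rewrite !inE => /orP[]/eqP-> //; apply: same_block_refl.
    by rewrite cards2 ab.
  by rewrite -(eqn_add2r 2) !subnK.
apply: eq_card => p; rewrite inE; apply/and3P/imsetP.
  move=> [/covered_botP[a [b [ab ->]]]]; rewrite merge2_le => Pab.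
  rewrite card_avoiding_coatoms_merge // (pow _ _ ab Pab) => Bk.
  exists (pblock (val P) a, [set a; b]) => //; rewrite !inE /= pblock_in Bk cards2 ab andbT.
  by apply/subsetP => i; rewrite !inE => /orP[]/eqP-> //; apply: same_block_refl.
move=> [[B D]]; rewrite !inE /= => /and4P[BP Bk DB /cards2P[a [b [ab DE]]]] ->; subst D.
have aB : a \in B by apply: (subsetP DB); rewrite !inE eqxx.
have bB : b \in B by apply: (subsetP DB); rewrite !inE eqxx orbT.
have Pab : same_block P a b by rewrite /same_block (pblockE BP aB).
split; first by apply/covered_botP; exists a, b.
  by rewrite merge2_le.
by rewrite card_avoiding_coatoms_merge // (pow _ _ ab Pab) (pblockE BP aB).
Qed.

End PartitionAtoms.

(** * Finite posets and products *)

Section FinitePosetFacts.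
Context {d : Order.disp_t} {T : finPOrderType d}.
Implicit Types x y z : T.

Lemma minimalP y : reflect (forall z, (z <= y)%O -> z = y) (minimal y).
Proof. by apply: (iffP forallP) => H z; [move/(implyP (H z))/eqP | apply/implyP => /H ->]. Qed.

Lemma exists_minimal_le x : exists y, minimal y && (y <= x)%O.
Proof.
case: (@arg_minnP _ x (<= x)%O (fun y => #|[set z | (z <= y)%O]|) (lexx x)) => y yx ymin.
exists y; apply/andP; split=> //; apply/minimalP => z zy; apply/eqP; apply: contraT => nzy.
have := ymin z (le_trans zy yx); rewrite leqNgt proper_card //.
apply/properP; split; first by apply/subsetP => u; rewrite !inE => /le_trans; apply.
by exists y; rewrite !inE ?lexx //; apply: contra nzy => yz; rewrite eq_le zy yz.
Qed.

Lemma exists_maximal_ge x : exists2 m, maximal m & (x <= m)%O.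
Proof.
case: (@arg_maxnP _ x (>= x)%O (fun y => #|[set z | (z <= y)%O]|) (lexx x)) => m xm mmax.
exists m => //; apply/forallP => z; apply/implyP => mz; apply: contraT => nzm.
have := mmax z (le_trans xm mz); rewrite /= leqNgt proper_card //.
apply/properP; split; first by apply/subsetP => u; rewrite !inE => /le_trans; apply.
by exists z; rewrite !inE ?lexx //; apply: contra nzm => zm; rewrite eq_le zm mz.
Qed.

Lemma rank_minimal y : minimal y -> rank y = 0%N.
Proof.
move=> /minimalP ymin; apply/eqP; rewrite /rank -leqn0 -subn1 leq_subLR addn0.
apply/bigmax_leqP => C /andP[_ /forall_inP Cy]; rewrite -(cards1 y).
by apply/subset_leq_card/subsetP => z /Cy/ymin ->; rewrite inE.
Qed.

End FinitePosetFacts.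

Lemma poset_iso_trans d1 d2 d3 (T : finPOrderType d1) (U : finPOrderType d2)
    (V : finPOrderType d3) : poset_iso T U -> poset_iso U V -> poset_iso T V.
Proof.
move=> [f [fb fm]] [g [gb gm]]; exists (g \o f); split; first exact: bij_comp.
by move=> x y /=; rewrite gm fm.
Qed.

(** An isomorphism from [subposet P] read backwards, as a map into the ambient poset, so that
    elements of the subtype need not be carried along. *)
Definition embeds_onto d d' (U : finPOrderType d) (T : finPOrderType d')
    (f : U -> T) (P : pred T) : Prop :=
  {mono f : u v / (u <= v)%O} /\ forall x, P x <-> exists u, f u = x.

Lemma subposet_embeds_onto d d' (T : finPOrderType d) (U : finPOrderType d')
    (P : pred T) : poset_iso (subposet P) U ->
  exists f : U -> T, embeds_onto f P.
Proof.
move=> [f [[g gK fK] fm]]; exists (fun u => val (g u)); split.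
  by move=> u v; transitivity (g u <= g v)%O; [by [] | rewrite -fm !fK].
move=> x; split=> [Px|[u <-]]; last exact: valP.
by exists (f (Sub x Px)); rewrite gK SubK.
Qed.

Lemma card_atoms_avoided_onto d d' (U : finPOrderType d) (T : finPOrderType d')
    (f : U -> T) (P : pred T) u v K : embeds_onto f P ->
  (forall x, (f u <= x <= f v)%O -> P x) ->
  #|atoms_avoided (f u) (f v) K| = #|atoms_avoided u v K|.
Proof.
by move=> [fm fP] sub; apply: card_atoms_avoided_embed => // x /sub/fP.
Qed.

(** * Block sizes of set partitions *)

Section BlockCounts.
Variable n : nat.
Implicit Types P R : partition_lattice n.

Lemma nblocks0 P : nblocks P 0 = 0%N.
Proof.
apply/eqP; rewrite cards_eq0 -subset0; apply/subsetP => B.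
rewrite !inE cards_eq0 => /andP[+ /eqP B0]; rewrite B0.
by have /and3P[_ _ /negPf ->] := valP P.
Qed.

Lemma nblocks_big P k : (n < k)%N -> nblocks P k = 0%N.
Proof.
move=> nk; apply/eqP; rewrite cards_eq0 -subset0; apply/subsetP => B.
rewrite !inE => /andP[_ /eqP Bk]; have := max_card (mem B).
by rewrite card_ord Bk leqNgt nk.
Qed.

(** Stated for any commutative monoid, to serve for sums and products alike. The size 0 drops out
    because no block is empty. *)
Lemma big_blocks (S : Type) (idx : S) (op : Monoid.com_law idx) (F : nat -> S) P :
  \big[op/idx]_(B in val P) F #|B| =
  \big[op/idx]_(i < n) \big[op/idx]_(B in [set B in val P | #|B| == i.+1]) F i.+1.
Proof.
pose c (B : {set 'I_n}) : 'I_n.+1 := inord #|B|.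
have cE (B : {set 'I_n}) : c B = #|B| :> nat.
  by rewrite inordK // ltnS (leq_trans (max_card _)) ?card_ord.
rewrite (partition_big c predT) //= big_ord_recl /= big1 ?Monoid.mul1m => [|B]; last first.
  move=> /andP[BP /eqP/(congr1 val)/eqP]; rewrite /= cE cards_eq0 => /eqP B0.
  by have /and3P[_ _] := valP P; rewrite -B0 BP.
apply: eq_bigr => i _; apply: eq_big => [B|B /andP[_ /eqP cB]]; last by rewrite -cE cB.
by rewrite inE -(inj_eq val_inj) /= cE.
Qed.

Lemma sum_nblocks P : (\sum_(i < n) i.+1 * nblocks P i.+1)%N = n.
Proof.
rewrite -[RHS]card_ord -cardsT (card_partition (valP P)) (big_blocks _ id).
by apply: eq_bigr => i _; rewrite sum_nat_const mulnC.
Qed.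

Lemma prod_nblocks (R : comNzRingType) (F : nat -> R) P :
  \prod_(B in val P) F #|B| = \prod_(i < n) F i.+1 ^+ nblocks P i.+1.
Proof. by rewrite big_blocks; apply: eq_bigr => i _; rewrite prodr_const. Qed.

Lemma nblocks_top P k : (0 < n)%N -> (forall R, (R <= P)%O) -> nblocks P k = (n == k) :> nat.
Proof.
move=> n0 Ptop.
have Tpart : partition [set [set: 'I_n]] [set: 'I_n].
  apply/and3P; split; first by rewrite /cover big_set1.
    by apply/trivIsetP => B C /set1P-> /set1P->; rewrite eqxx.
  by rewrite inE eq_sym; apply/set0Pn; exists (Ordinal n0).
have -> : P = Sub [set [set: 'I_n]] Tpart.
  apply: le_anti; rewrite Ptop andbT; apply/refinesP => B BP.
  by exists [set: 'I_n]; rewrite ?subsetT // SubK inE.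
rewrite /nblocks SubK; have [nk|nk] := eqVneq n k.
  transitivity #|[set [set: 'I_n]]|; last by rewrite cards1.
  by apply: eq_card => B; rewrite !inE; case: eqP => // ->; rewrite cardsT card_ord nk eqxx.
apply/eqP; rewrite cards_eq0 -subset0; apply/subsetP => B.
by rewrite !inE => /andP[/eqP->]; rewrite cardsT card_ord (negPf nk).
Qed.

End BlockCounts.

(** * Sums over product posets *)

Section ProductSums.
Context {d : Order.disp_t} {J : finType} {P : J -> finPOrderType d}.

Lemma prod_poset_distr (R : comNzRingType) (F : forall j, P j -> R) :
  \sum_(h : prod_poset P) \prod_j F j (h j) = \prod_j \sum_(q : P j) F j q.
Proof.
pose G j := [ffun q : P j => F j q].
have GE j q : G j q = F j q by rewrite ffunE.
have E j : \sum_(q : P j) F j q = \sum_(u in tagged_with P j) untag 0 (G j) u.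
  transitivity (\sum_(q : P j) G j q); first by apply: eq_bigr => q _; rewrite GE.
  exact: (big_tag (T_ := fun j => P j) (fun j q => G j q) j).
rewrite (eq_bigr _ (fun j _ => E j)) bigA_distr_big_dep /=.
rewrite -(big_fprod 1 +%R G) (reindex _ (onW_bij _ (dffun_of_fprod_bij P))) /=.
by apply: eq_bigr => t _; apply: eq_bigr => j _; rewrite GE ffunE.
Qed.

Lemma prod_poset_distr_le (R : comNzRingType) (F : forall j, P j -> R) (g : prod_poset P) :
  \sum_(h : prod_poset P | (h <= g)%O) \prod_j F j (h j) =
  \prod_j \sum_(q : P j | (q <= g j)%O) F j q.
Proof.
under [RHS]eq_bigr do rewrite big_mkcond.
rewrite -(prod_poset_distr (fun j q => if (q <= g j)%O then F j q else 0)) big_mkcond.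
apply: eq_bigr => h _; case: (boolP (h <= g)%O) => [/prod_leP hg|/forallPn[j hj]].
  by apply: eq_bigr => j _; rewrite hg.
by rewrite (bigD1 j) //= (negPf hj) mul0r.
Qed.

Lemma minimal_prod (h : prod_poset P) : minimal h = [forall j, minimal (h j)].
Proof.
apply/minimalP/forallP => [H j|H g gh].
  apply/minimalP => q qh; have := H (replace h q); rewrite replace_le // => /(_ qh).
  by move/(congr1 (fun g : prod_poset P => g j)); rewrite replace_in.
by apply: prod_posetP => j; apply: (minimalP _ (H j)); apply: (prod_leP _ _ gh).
Qed.

End ProductSums.

(** * Types in exponential structures *)

Section ExponentialStructureTheory.
Context {d : Order.disp_t} (Q : nat -> finPOrderType d).
Hypothesis hQ : exponential_structure Q.

Lemma exists_top n : (0 < n)%N -> exists t : Q n, forall x, (x <= t)%O.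
Proof.
move=> n0; have [t [tmax tuniq]] := exp_unique_maximal hQ n0.
by exists t => x; have [m mmax xm] := exists_maximal_ge x; rewrite (tuniq m mmax).
Qed.

Lemma top_maximal n (t : Q n) : (forall x, (x <= t)%O) -> maximal t.
Proof. by move=> tt; apply/forallP => y; apply/implyP => ty; rewrite eq_le tt. Qed.

(** A minimal element has rank 0, so the interval from it to the top is a full partition lattice. *)
Lemma upper_param n (y : Q n) : (0 < n)%N -> minimal y ->
  exists psi : partition_lattice n -> Q n, embeds_onto psi (>= y)%O.
Proof.
move=> n0 ymin; have [t tt] := exists_top n0.
have := exp_upper_interval hQ n0 y (top_maximal tt).
rewrite (rank_minimal ymin) subn0 => /subposet_embeds_onto[f [fm fP]].
by exists f; split=> // x; rewrite -fP /= tt andbT.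
Qed.

Lemma upper_bot n (y : Q n) (psi : partition_lattice n -> Q n) : embeds_onto psi (>= y)%O ->
  exists2 bot : partition_lattice n, psi bot = y & forall R, (bot <= R)%O.
Proof.
move=> [fm fP]; have [bot botE] := (fP y).1 (lexx y).
by exists bot => // R; rewrite -fm botE; apply/fP; exists R.
Qed.

Lemma card_atoms_upper n (y : Q n) (psi : partition_lattice n -> Q n) P k :
  embeds_onto psi (>= y)%O -> (1 < k)%N ->
  #|atoms_avoided y (psi P) (2 ^ (k - 2))%N| = (nblocks P k * 'C(k, 2))%N.
Proof.
move=> psiP k1; have [bot botE bot_le] := upper_bot psiP.
rewrite -[X in atoms_avoided X]botE (card_atoms_avoided_onto _ psiP).
  exact: card_atoms_avoided_partition.
by move=> x /andP[]; rewrite botE.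
Qed.

Lemma nblocks_upper_top n (y t : Q n) (psi : partition_lattice n -> Q n) P k :
  (0 < n)%N -> embeds_onto psi (>= y)%O ->
  (forall x, (x <= t)%O) -> psi P = t -> nblocks P k = (n == k).
Proof. by move=> n0 [fm _] tt Pt; apply: nblocks_top => // R; rewrite -fm Pt. Qed.

Lemma card_atoms_top n (y t : Q n) k : (0 < n)%N -> minimal y ->
  (forall x, (x <= t)%O) -> (1 < k)%N ->
  #|atoms_avoided y t (2 ^ (k - 2))%N| = ((n == k) * 'C(k, 2))%N.
Proof.
move=> n0 ymin tt k1; have [psi psiP] := upper_param n0 ymin.
have [P Pt] := (psiP.2 t).1 (tt y).
by rewrite -Pt card_atoms_upper // (nblocks_upper_top _ n0 psiP tt Pt).
Qed.

Section LowerIdeal.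
Variables (n : nat) (x : Q n) (a : 'I_n -> nat) (theta : type_poset Q a -> Q n).
Hypothesis thetaP : embeds_onto theta (<= x)%O.
Implicit Types g h : type_poset Q a.

Lemma lower_le g : (theta g <= x)%O.
Proof. by apply/thetaP.2; exists g. Qed.

Lemma lower_surj z : (z <= x)%O -> exists g, theta g = z.
Proof. by move/thetaP.2. Qed.

Lemma lower_inj : injective theta.
Proof. exact: inc_inj thetaP.1. Qed.

Lemma lower_minimal g : minimal (theta g) = [forall j, minimal (g j)].
Proof.
rewrite -minimal_prod; apply/minimalP/minimalP => H.
  by move=> h hg; apply: lower_inj; apply: H; rewrite thetaP.1.
move=> z zg; have [h hz] := lower_surj (le_trans zg (lower_le g)).
by rewrite -hz (H h) // -thetaP.1 hz.
Qed.

Lemma lower_top h (j : {i : 'I_n & 'I_(a i)}) (q : Q (tag j).+1) : theta h = x -> (q <= h j)%O.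
Proof.
move=> hx; have /prod_leP/(_ j) : (replace h q <= h)%O by rewrite -thetaP.1 hx lower_le.
by rewrite replace_in.
Qed.

Lemma card_atoms_lower g h K : (g <= h)%O ->
  #|atoms_avoided (theta g) (theta h) K| =
  (\sum_j #|atoms_avoided (g j) (h j) K|)%N.
Proof.
move=> gh; rewrite (card_atoms_avoided_onto _ thetaP); first exact: card_atoms_avoided_prod.
by move=> z /andP[_ zh]; apply: le_trans zh (lower_le h).
Qed.

Lemma big_type (R : Type) (idx : R) (op : Monoid.com_law idx) (F : nat -> R) :
  \big[op/idx]_(j : {i : 'I_n & 'I_(a i)}) F (tag j) =
  \big[op/idx]_(i < n) \big[op/idx]_(k < a i) F i.
Proof. by rewrite sig_big_dep. Qed.

(** By additivity only the factors [Q i.+1] contribute, each with the value given by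
    [card_atoms_top]. The result is the same for all minimal [y], which makes types independent of
    choices. *)
Lemma card_atoms_type y (i : 'I_n) : minimal y -> (y <= x)%O -> (0 < i)%N ->
  #|atoms_avoided y x (2 ^ (i.+1 - 2))%N| = (a i * 'C(i.+1, 2))%N.
Proof.
move=> ymin yx i0; have [g gy] := lower_surj yx; have [h hx] := lower_surj (lexx x).
rewrite -gy -[X in atoms_avoided _ X]hx card_atoms_lower; last first.
  by rewrite -thetaP.1 gy hx.
move: ymin; rewrite -gy lower_minimal => /forallP gmin.
transitivity (\sum_(j : {i : 'I_n & 'I_(a i)}) ((tag j == i :> nat) * 'C(i.+1, 2)))%N.
  by apply: eq_bigr => j _; rewrite card_atoms_top // => q; apply: lower_top.
rewrite (big_type _ (fun m => ((m == i) * 'C(i.+1, 2))%N)) (bigD1 i) //=.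
rewrite [X in (_ + X)%N]big1 => [|k ki].
  by rewrite eqxx sum_nat_const card_ord mul1n addn0.
by rewrite (negPf (ki : (k : nat) != i)) sum_nat_const muln0.
Qed.

End LowerIdeal.

Definition minimal_below n (x : Q n) : Q n := odflt x [pick y | minimal y && (y <= x)%O].

Lemma minimal_belowP n (x : Q n) : minimal (minimal_below x) /\ (minimal_below x <= x)%O.
Proof.
rewrite /minimal_below; case: pickP => [y /andP[]//|none].
by have [y] := exists_minimal_le x; rewrite none.
Qed.

(* The number of factors [Q_k] in the lower ideal of [x]; the trivial factors
   [Q_1] are counted by normalization. *)
Definition nfactors n (x : Q n) k : nat :=
  let count k := (#|atoms_avoided (minimal_below x) x (2 ^ (k - 2))%N| %/ 'C(k, 2))%N in
  if k == 1%N then (n - \sum_(1 <= i < n) i.+1 * count i.+1)%N else count k.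

(** [nfactors] starts from one chosen minimal element, [P] from an arbitrary one. The counts from
    both are compared through a type of [x], by [card_atoms_type]. *)
Lemma nfactors_upper n (x y : Q n) (psi : partition_lattice n -> Q n) P k :
  (0 < n)%N -> minimal y ->
  embeds_onto psi (>= y)%O -> psi P = x -> nfactors x k = nblocks P k.
Proof.
move=> n0 ymin psiP Px.
have yx : (y <= x)%O by apply/psiP.2; exists P.
have [zmin zx] := minimal_belowP x.
have count i : (1 < i)%N ->
    #|atoms_avoided (minimal_below x) x (2 ^ (i - 2))%N| = (nblocks P i * 'C(i, 2))%N.
  (* A type of [x] has no entry beyond [n], and neither partition has a block that large. *)
  move=> i1; case: (leqP i n) => [ni|ni]; last first.
    have [psi' psi'P] := upper_param n0 zmin; have [P' P'x] := (psi'P.2 x).1 zx.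
    by have := card_atoms_upper P' psi'P i1; rewrite P'x !nblocks_big.
  rewrite -(card_atoms_upper _ psiP) // Px.
  have [a /subposet_embeds_onto[theta thetaP]] := exp_lower_ideal hQ n0 x.
  case: i i1 ni => // i i1 ni.
  have atomsE z := card_atoms_type (y := z) thetaP (i := Ordinal ni).
  by rewrite /= in atomsE; rewrite !atomsE.
(* For [k = 0] the quotient by ['C(0, 2) = 0] is 0 by convention, and no block is empty. For [k = 1]
   both sides are fixed by the total size [n]. *)
rewrite /nfactors; case: k => [|[|k]] /=; first by rewrite bin0n divn0 nblocks0.
  rewrite -[X in (X - _)%N](sum_nblocks P).
  rewrite -(big_mkord xpredT (fun i => i.+1 * nblocks P i.+1)%N) big_ltn // mul1n.
  rewrite [X in (_ - X)%N](_ : _ = \sum_(1 <= i < n) i.+1 * nblocks P i.+1)%N.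
    by rewrite addnK.
  by apply: eq_big_nat => i /andP[i1 _]; rewrite count ?mulnK ?bin_gt0.
by rewrite count ?mulnK ?bin_gt0.
Qed.
End ExponentialStructureTheory.

(** * Existence, uniqueness and additivity of types *)

Section TypeTheory.
Context {d : Order.disp_t} (Q : nat -> finPOrderType d).
Hypothesis hQ : exponential_structure Q.

Lemma nfactors_shape n (x : Q n) : (0 < n)%N ->
  exists P : partition_lattice n, forall k, nfactors x k = nblocks P k.
Proof.
move=> n0; have [ymin yx] := minimal_belowP x.
have [psi psiP] := upper_param hQ n0 ymin; have [P Px] := (psiP.2 x).1 yx.
by exists P => k; apply: nfactors_upper ymin psiP Px.
Qed.

Lemma nfactors0 n (x : Q n) : nfactors x 0 = 0%N.
Proof. by rewrite /nfactors /= bin0n divn0. Qed.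

Lemma nfactors_big n (x : Q n) k : (0 < n)%N -> (n < k)%N -> nfactors x k = 0%N.
Proof. by move=> n0 nk; have [P ->] := nfactors_shape x n0; apply: nblocks_big. Qed.

Lemma sum_nfactors n (x : Q n) : (0 < n)%N -> (\sum_(i < n) i.+1 * nfactors x i.+1)%N = n.
Proof.
move=> n0; have [P PE] := nfactors_shape x n0; under eq_bigr do rewrite PE.
exact: sum_nblocks.
Qed.

Lemma sum_nfactors_widen n N (x : Q n) : (0 < n)%N -> (n <= N)%N ->
  (\sum_(i < N) i.+1 * nfactors x i.+1)%N = n.
Proof.
move=> n0 nN; rewrite -[RHS](sum_nfactors x n0).
rewrite [RHS](big_ord_widen N (fun i => i.+1 * nfactors x i.+1)%N nN).
rewrite [RHS]big_mkcond; apply: eq_bigr => i _; case: ltnP => // ni.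
by rewrite nfactors_big ?muln0.
Qed.

Lemma nfactors_top n (t : Q n) k : (0 < n)%N -> (forall x, (x <= t)%O) ->
  nfactors t k = (n == k).
Proof.
move=> n0 tt; have [ymin yt] := minimal_belowP t.
have [psi psiP] := upper_param hQ n0 ymin; have [P Pt] := (psiP.2 t).1 yt.
by rewrite (nfactors_upper hQ _ n0 ymin psiP Pt) (nblocks_upper_top _ n0 psiP tt Pt).
Qed.

Lemma card_atoms_nfactors n (x y : Q n) k : (0 < n)%N -> minimal y -> (y <= x)%O ->
  (1 < k)%N -> #|atoms_avoided y x (2 ^ (k - 2))%N| = (nfactors x k * 'C(k, 2))%N.
Proof.
move=> n0 ymin yx k1; have [psi psiP] := upper_param hQ n0 ymin.
have [P Px] := (psiP.2 x).1 yx.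
by rewrite (nfactors_upper hQ _ n0 ymin psiP Px) -(card_atoms_upper _ psiP) ?Px.
Qed.

Lemma nfactors_type n (x : Q n) (a : 'I_n -> nat) (i : 'I_n) : (0 < n)%N ->
  poset_iso (lower_ideal x) (type_poset Q a) -> (0 < i)%N -> a i = nfactors x i.+1.
Proof.
move=> n0 /subposet_embeds_onto[theta thetaP] i0; have [ymin yx] := minimal_belowP x.
have := card_atoms_type hQ thetaP ymin yx i0.
rewrite card_atoms_nfactors // => /eqP; rewrite eqn_pmul2r ?bin_gt0 // => /eqP.
by [].
Qed.

(** An element and the top both lie above a common minimal element, in an interval isomorphic to the
    partition lattice of one point. *)
Lemma Q1_unique (p q : Q 1) : p = q.
Proof.
have [t tt] := exists_top hQ (ltn0Sn 0).
suff all_t z : z = t by rewrite (all_t p) (all_t q).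
have [ymin yz] := minimal_belowP z; have [psi psiP] := upper_param hQ (ltn0Sn 0) ymin.
have [P Pz] := (psiP.2 z).1 yz; have [R Rt] := (psiP.2 t).1 (tt _).
rewrite -Pz -Rt; congr psi; apply: le_anti; apply/andP.
by split; apply/le_partitionP => i j _; rewrite (ord1 i) (ord1 j) same_block_refl.
Qed.

(** Only the exponents of [Q 1] may differ, and [Q 1] is a single point. *)
Lemma type_poset_iso n (a b : 'I_n -> nat) : (forall i : 'I_n, (0 < i)%N -> a i = b i) ->
  poset_iso (type_poset Q a) (type_poset Q b).
Proof.
have ex m : exists t : Q m.+1, true by have [t] := exists_top hQ (ltn0Sn m); exists t.
pose dflt m : Q m.+1 := xchoose (ex m).
have unique (i : 'I_n) : val i = 0%N -> forall p q : Q i.+1, p = q.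
  by case: i => -[|m] H //= _; apply: Q1_unique.
(* A coordinate is copied when the source has one with the same number, and is a default point
   otherwise; for the exponents at hand, the default occurs only in factors [Q 1]. *)
pose F (a b : 'I_n -> nat) (g : type_poset Q a) : type_poset Q b :=
  [ffun j : {i : 'I_n & 'I_(b i)} =>
    (if insub (val (tagged j)) is Some k then g (Tagged (fun i => 'I_(a i)) k)
     else dflt (tag j)) : Q (tag j).+1].
have FE a' b' (g : type_poset Q a') (i : 'I_n) (k : 'I_(a' i)) (l : 'I_(b' i)) :
    val k = val l -> F a' b' g (Tagged (fun i => 'I_(b' i)) l) = g (Tagged (fun i => 'I_(a' i)) k).
  by rewrite ffunE /= => <-; rewrite valK.
have FK a' b' : (forall i : 'I_n, (0 < i)%N -> a' i = b' i) -> cancel (F a' b') (F b' a').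
  move=> ab g; apply: prod_posetP => -[i k].
  have [i0|i0] := posnP i; first exact: unique.
  by rewrite (FE _ _ _ _ (cast_ord (ab i i0) k)) // (FE _ _ _ _ k).
move=> ab; exists (F a b); split.
  by exists (F b a); apply: FK => // i i0; rewrite ab.
move=> g h; apply/prod_leP/prod_leP => gh [i k].
  have [i0|i0] := posnP i; first by rewrite (unique i i0 (g (existT _ i k)) (h (existT _ i k))).
  have := gh (Tagged (fun i => 'I_(b i)) (cast_ord (ab i i0) k)).
  by rewrite !(FE _ _ _ _ k).
by rewrite !ffunE /=; case: insub => [l|]; [exact: gh | exact: lexx].
Qed.

(** The exponents given by [exp_lower_ideal] are right except perhaps that of [Q 1], which is
    replaced by the normalized one. *)
Lemma is_type_nfactors n (x : Q n) : (0 < n)%N -> is_type x (fun i => nfactors x i.+1).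
Proof.
move=> n0; split; last exact: sum_nfactors.
have [a ax] := exp_lower_ideal hQ n0 x; apply: (poset_iso_trans ax).
by apply: type_poset_iso => i i0; apply: nfactors_type ax i0.
Qed.

Lemma is_type_unique n (x : Q n) a : (0 < n)%N -> is_type x a ->
  forall i, a i = nfactors x i.+1.
Proof.
case: n x a => // n x a _ [ax asum] i; have [i0|i0] := posnP i; last exact: nfactors_type ax i0.
have := sum_nfactors x (ltn0Sn n); rewrite -[RHS]asum !big_ord_recl !mul1n.
rewrite [X in (_ + X)%N](eq_bigr (fun j : 'I_n => (lift ord0 j).+1 * a (lift ord0 j)))%N.
  by move/addIn; rewrite (ord_inj (i0 : i = ord0 :> nat)).
by move=> j _; rewrite -(nfactors_type _ ax).
Qed.

Lemma weighted_sum_inj1 n (u v : nat -> nat) : (0 < n)%N ->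
  (forall k, (1 < k)%N -> u k = v k) ->
  (\sum_(i < n) i.+1 * u i.+1 = \sum_(i < n) i.+1 * v i.+1)%N -> u 1%N = v 1%N.
Proof.
case: n => // n _ uv; rewrite !big_ord_recl !mul1n.
rewrite [X in (_ + X)%N](eq_bigr (fun i : 'I_n => (lift ord0 i).+1 * v (lift ord0 i).+1))%N.
  by move/addIn.
by move=> i _; rewrite uv.
Qed.

(** For [k > 1] this is additivity of the atom count on products. For [k = 1] the two sides are
    forced to agree by their equal total weights. *)
Lemma nfactors_lower n (x : Q n) (a : 'I_n -> nat) (theta : type_poset Q a -> Q n) g k :
  (0 < n)%N -> (\sum_(i < n) i.+1 * a i)%N = n -> embeds_onto theta (<= x)%O ->
  nfactors (theta g) k = (\sum_j nfactors (g j) k)%N.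
Proof.
move=> n0 an thetaP; have [ymin yg] := minimal_belowP (theta g).
have [h hy] := lower_surj thetaP (le_trans yg (lower_le thetaP g)).
move: ymin yg; rewrite -hy (lower_minimal thetaP) thetaP.1 => /forallP hmin hg.
have big k' : (1 < k')%N -> nfactors (theta g) k' = (\sum_j nfactors (g j) k')%N.
  move=> k1; apply/eqP; rewrite -(eqn_pmul2r (_ : 0 < 'C(k', 2))%N) ?bin_gt0 //.
  rewrite -(card_atoms_nfactors (y := theta h)) ?thetaP.1 ?(lower_minimal thetaP) //;
    last exact/forallP.
  rewrite (card_atoms_lower thetaP) // big_distrl /=; apply/eqP; apply: eq_bigr => j _.
  by rewrite card_atoms_nfactors //; apply: (prod_leP _ _ hg).
case: k => [|[|k]]; last exact: big.
  by rewrite nfactors0 big1 // => j _; rewrite nfactors0.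
(* The coordinate [j] contributes the index [(tag j).+1] of its factor, and these add up to [n] by
   [an]. *)
have total : (\sum_(i < n) i.+1 * (\sum_j nfactors (g j) i.+1))%N = n.
  under eq_bigr do rewrite big_distrr /=.
  rewrite exchange_big /= -[RHS]an.
  transitivity (\sum_(j : {i : 'I_n & 'I_(a i)}) (tag j).+1)%N.
    by apply: eq_bigr => j _; rewrite sum_nfactors_widen.
  rewrite (big_type a _ (fun m => m.+1)); apply: eq_bigr => i _.
  by rewrite sum_nat_const card_ord mulnC.
apply: (@weighted_sum_inj1 n (nfactors (theta g)) (fun k => \sum_j nfactors (g j) k)%N) => //.
by rewrite total sum_nfactors.
Qed.

Variable I : set nat.

(** Uniqueness of the normalized type removes the existential quantifier of [in_restriction]. *)
Lemma in_restrictionP n (x : Q n) : (0 < n)%N ->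
  reflect (forall k, (0 < nfactors x k)%N -> k \in I) (in_restriction I x).
Proof.
move=> n0; apply: (iffP (asboolP _)) => [[a ax aI] k|H].
  case: k => [|k]; first by rewrite nfactors0.
  case: (ltnP k n) => [kn|nk]; last by rewrite nfactors_big.
  by move=> kx; apply: (aI (Ordinal kn)); rewrite (is_type_unique n0 ax).
by exists (fun i => nfactors x i.+1) => [|i]; [exact: is_type_nfactors | exact: H].
Qed.

Lemma in_restriction_lower n (x : Q n) (a : 'I_n -> nat) (theta : type_poset Q a -> Q n) g :
  (0 < n)%N -> (\sum_(i < n) i.+1 * a i)%N = n -> embeds_onto theta (<= x)%O ->
  in_restriction I (theta g) = [forall j, in_restriction I (g j)].
Proof.
move=> n0 an thetaP; apply/in_restrictionP/forallP => // H.
  move=> j; apply/in_restrictionP => // k kj; apply: H.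
  rewrite (nfactors_lower _ _ n0 an thetaP) (bigD1 j) //=.
  by rewrite (leq_trans kj) ?leq_addr.
move=> k; rewrite (nfactors_lower _ _ n0 an thetaP) lt0n sum_nat_eq0 => /forallPn[j].
by rewrite /= -lt0n; apply: (in_restrictionP _ _ (H j)).
Qed.

Lemma in_restriction_top n (t : Q n) : (0 < n)%N -> (forall x, (x <= t)%O) ->
  in_restriction I t = (n \in I).
Proof.
move=> n0 tt; apply/in_restrictionP/idP => // [|nI k].
  by apply; rewrite nfactors_top // eqxx.
by rewrite nfactors_top //; case: eqP => // <-.
Qed.

End TypeTheory.

(** * Moebius functions of restricted posets *)

Lemma sum_with_bot (d : Order.disp_t) (T : finPOrderType d) (R : nmodType)
    (P : pred (with_bot T)) (F : with_bot T -> R) : P None ->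
  \sum_(z | P z) F z = F None + \sum_(x : T | P (Some x)) F (Some x).
Proof.
move=> PN; rewrite (bigD1 None) //=; congr (_ + _).
rewrite (reindex_omap (fun x : T => Some x : with_bot T) id) => [|[x|]] //=; last first.
  by rewrite andbF.
by apply: eq_bigl => x; rewrite andbT eqxx andbT.
Qed.

Section RestrictedMobius.
Context {d : Order.disp_t} (Q : nat -> finPOrderType d).
Hypothesis hQ : exponential_structure Q.
Variable I : set nat.

(** Extending by 0 outside the restricted poset lets sums run over all of [Q n]. The sign makes the
    function multiplicative, its sums over lower ideals of restricted elements being 1. *)
Definition neg_mobius n (x : Q n) : rat :=
  if insub x : option (restricted Q I n) is Some u
  then - (mobius (None : restricted_bot Q I n) (Some u))%:~R else 0.

Lemma neg_mobius_out n (x : Q n) : ~~ in_restriction I x -> neg_mobius x = 0.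
Proof. by move=> xI; rewrite /neg_mobius insubN. Qed.

Lemma neg_mobius_val n (u : restricted Q I n) :
  neg_mobius (val u) = - (mobius (None : restricted_bot Q I n) (Some u))%:~R.
Proof. by rewrite /neg_mobius valK. Qed.

Lemma sum_neg_mobius n (P : pred (Q n)) : \sum_(z | P z) neg_mobius z =
  - (\sum_(u : restricted Q I n | P (val u)) mobius (None : restricted_bot Q I n) (Some u))%:~R.
Proof.
rewrite (bigID (@in_restriction d Q I n)) /= [X in _ + X]big1 ?addr0; last first.
  by move=> z /andP[_ /neg_mobius_out].
rewrite (reindex_omap (fun u : restricted Q I n => val u) insub) => [|z /andP[_ zI]]; last first.
  by rewrite insubT.
rewrite rmorph_sum /= -sumrN; apply: eq_big => [u|u _]; last exact: neg_mobius_val.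
by rewrite valK eqxx andbT (valP u) andbT.
Qed.

(** The Moebius function sums to 0 over [[0, x]], and the adjoined minimum contributes 1. *)
Lemma sum_neg_mobius_le n (x : Q n) : in_restriction I x ->
  \sum_(z | (z <= x)%O) neg_mobius z = 1.
Proof.
move=> xI; rewrite sum_neg_mobius (bigD1 (Sub x xI)) ?SubK ?lexx //=.
have lt : ((None : restricted_bot Q I n) < Some (Sub x xI))%O by rewrite lt_def.
rewrite (mobius_lt lt) sum_with_bot // mobius_refl.
rewrite (eq_bigl (fun u : restricted Q I n => (val u <= x)%O && (u != Sub x xI))).
  by rewrite opprD addrNK rmorphN /= opprK.
move=> u /=; rewrite lt_neqAle andbC; congr (_ && _).
Qed.

Lemma m_restrictedE n : (m_restricted Q I n)%:~R = 1 - \sum_(x : Q n) neg_mobius x.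
Proof.
by rewrite /m_restricted rmorphD /= (sum_neg_mobius xpredT) opprK.
Qed.

Lemma neg_mobius_top n (t : Q n) : (0 < n)%N -> (forall x, (x <= t)%O) ->
  neg_mobius t = - (mu_restricted Q I n)%:~R.
Proof.
move=> n0 tt; have tI := in_restriction_top hQ I n0 tt; rewrite /mu_restricted.
have [nI|nI] := boolP (n \in I); last first.
  by rewrite neg_mobius_out ?oppr0 // tI.
have {}tI : in_restriction I t by rewrite tI.
have top : [forall x : restricted_bot Q I n, (x <= Some (Sub t tI))%O].
  by apply/forallP => -[u|] //; apply: tt.
case: pickP => [s /forallP stop|/(_ (Some (Sub t tI)))]; last by rewrite top.
have -> : s = Some (Sub t tI).
  by apply: le_anti; rewrite stop (forallP top).
by rewrite -neg_mobius_val SubK.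
Qed.

Section Lower.
Variables (n : nat) (x : Q n) (a : 'I_n -> nat) (theta : type_poset Q a -> Q n).
Hypothesis n0 : (0 < n)%N.
Hypothesis an : (\sum_(i < n) i.+1 * a i)%N = n.
Hypothesis thetaP : embeds_onto theta (<= x)%O.

Lemma reindex_lower (R : nmodType) (F : Q n -> R) g :
  \sum_(z | (z <= theta g)%O) F z = \sum_(h | (h <= g)%O) F (theta h).
Proof.
rewrite (reindex_omap theta (fun z => [pick h | theta h == z])) => [|z zg]; last first.
  have [h hz] := lower_surj thetaP (le_trans zg (lower_le thetaP g)).
  by case: pickP => [h' /= /eqP->//|/(_ h)]; rewrite hz eqxx.
apply: eq_bigl => h; rewrite thetaP.1; case: pickP => [h' /eqP/(lower_inj thetaP)->|/(_ h)].
  by rewrite eqxx andbT.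
by rewrite eqxx.
Qed.

(** If [theta g] is restricted, both sides have sum 1 over the elements below [g], and induction on
    the size of the lower ideal compares the values at [g]. Otherwise some coordinate is not
    restricted either, and both sides vanish. *)
Lemma neg_mobius_lower g : neg_mobius (theta g) = \prod_j neg_mobius (g j).
Proof.
have [m] := ubnP #|[set h : type_poset Q a | (h <= g)%O]|; elim: m => // m IH in g *.
rewrite ltnS => gm; have [gI|gI] := boolP (in_restriction I (theta g)); last first.
  rewrite neg_mobius_out //; move: gI.
  rewrite (in_restriction_lower hQ I g n0 an thetaP) => /forallPn[j gj].
  by rewrite (bigD1 j) //= neg_mobius_out ?mul0r.
have : \sum_(h | (h <= g)%O) neg_mobius (theta h) =
    \sum_(h | (h <= g)%O) \prod_j neg_mobius (h j).
  rewrite -reindex_lower sum_neg_mobius_le // (prod_poset_distr_le (fun j q => neg_mobius q)).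
  rewrite big1 // => j _; apply: sum_neg_mobius_le.
  by move: gI; rewrite (in_restriction_lower hQ I g n0 an thetaP) => /forallP.
rewrite (bigD1 g) //= [in RHS](bigD1 g) //=.
rewrite [X in _ + X = _](_ : _ = \sum_(h : type_poset Q a | (h <= g)%O && (h != g))
    \prod_j neg_mobius (h j)); first by move/addIr.
apply: eq_bigr => h /andP[hg nhg]; apply: IH; apply: leq_trans gm.
apply: proper_card; apply/properP; split.
  by apply/subsetP => u; rewrite !inE => /le_trans; apply.
by exists g; rewrite !inE ?lexx //; apply: contra nhg => gh; rewrite eq_le hg gh.
Qed.

(** Minimality in a product is coordinatewise; written as a product of 0-1 indicators, it makes the
    count factor by [prod_poset_distr_le]. *)
Lemma card_minimal_lower :
  #|[set y : Q n | minimal y && (y <= x)%O]|%:R =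
    \prod_(j : {i : 'I_n & 'I_(a i)}) (denom Q (tag j).+1)%:R :> rat.
Proof.
have [h hx] := lower_surj thetaP (lexx x).
rewrite -sum1_card natr_sum big_mkcond /=.
transitivity (\sum_(z | (z <= theta h)%O) (minimal z)%:R : rat).
  rewrite hx [RHS]big_mkcond; apply: eq_bigr => z _.
  by rewrite inE; case: (minimal z); case: (z <= x)%O.
rewrite reindex_lower.
transitivity (\sum_(g | (g <= h)%O) \prod_j (minimal (g j))%:R : rat).
  apply: eq_bigr => g _; rewrite (lower_minimal thetaP).
  case: forallP => [H|/forallP/forallPn[j /negPf gj]].
    by rewrite big1 // => j _; rewrite H.
  by rewrite (bigD1 j) //= gj mul0r.
rewrite (prod_poset_distr_le (fun j q => (minimal q)%:R)); apply: eq_bigr => j _.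
rewrite -natr_sum; congr (_%:R); rewrite /denom /= -sum1_card [RHS]big_mkcond /=.
rewrite (eq_bigl xpredT) => [|q]; last by rewrite (lower_top thetaP).
by apply: eq_bigr => q _; rewrite inE; case: minimal.
Qed.

End Lower.

Definition weight k : rat := - (mu_restricted Q I k)%:~R / (denom Q k)%:R.

Lemma denom_neq0 n : (denom Q n)%:R != 0 :> rat.
Proof.
rewrite pnatr_eq0 /denom; case: n => // n /=; rewrite cards_eq0.
have [t _] := exists_top hQ (ltn0Sn n); have [y /andP[ymin _]] := exists_minimal_le t.
by apply/set0Pn; exists y; rewrite inE.
Qed.

(** Numerator and denominator are products over the factors of the lower ideal of [x], and
    [nfactors] matches these factors with the blocks of [P] by size. *)
Lemma neg_mobius_upper n (x y : Q n) (psi : partition_lattice n -> Q n) P :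
  (0 < n)%N -> minimal y -> embeds_onto psi (>= y)%O -> psi P = x ->
  neg_mobius x / #|[set y : Q n | minimal y && (y <= x)%O]|%:R =
    \prod_(B in val P) weight #|B|.
Proof.
move=> n0 ymin psiP Px; have [iso an] := is_type_nfactors hQ x n0.
have [theta thetaP] := subposet_embeds_onto iso.
have [h hx] := lower_surj thetaP (lexx x).
rewrite (card_minimal_lower thetaP) -[in X in X / _]hx (neg_mobius_lower n0 an thetaP).
rewrite -prodf_div.
transitivity (\prod_(j : {i : 'I_n & 'I_(nfactors x i.+1)}) weight (tag j).+1).
  apply: eq_bigr => j _; rewrite neg_mobius_top // => q.
  exact: (lower_top thetaP).
rewrite (big_type (fun i : 'I_n => nfactors x i.+1) _ (fun i => weight i.+1)).
rewrite prod_nblocks; apply: eq_bigr => i _; rewrite prodr_const card_ord.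
by rewrite (nfactors_upper hQ _ n0 ymin psiP Px).
Qed.

Lemma sum_neg_mobius_partitions n : (0 < n)%N ->
  \sum_(x : Q n) neg_mobius x = (denom Q n)%:R * partition_number weight n.
Proof.
move=> n0; pose c (x : Q n) : rat := #|[set y : Q n | minimal y && (y <= x)%O]|%:R.
have c0 x : c x != 0.
  rewrite pnatr_eq0 cards_eq0; apply/set0Pn.
  by have [y] := exists_minimal_le x; exists y; rewrite inE.
(* The value at [x] is shared equally among the minimal elements below [x], so that the summation
   can start from [y]. *)
transitivity (\sum_(x : Q n) \sum_(y : Q n | minimal y && (y <= x)%O) neg_mobius x / c x).
  apply: eq_bigr => x _; rewrite sumr_const -mulr_natr.
  by rewrite (_ : _%:R = c x) ?divfK // /c cardsE.
rewrite (exchange_big_dep minimal) /= => [|x y _ /andP[]//].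
transitivity (\sum_(y : Q n | minimal y) partition_number weight n).
  apply: eq_bigr => y ymin; have [psi psiP] := upper_param hQ n0 ymin.
  have psi_inj : injective psi := inc_inj psiP.1.
  rewrite (reindex_omap psi (fun z => [pick P | psi P == z])) => [|z]; last first.
    rewrite ymin /= => /psiP.2[P Pz].
    by case: pickP => [P' /= /eqP->//|/(_ P)]; rewrite Pz eqxx.
  rewrite (eq_bigl xpredT) => [|P]; last first.
    rewrite ymin /= (_ : (y <= psi P)%O); last by apply/psiP.2; exists P.
    by case: pickP => [P' /eqP/psi_inj->|/(_ P)]; rewrite eqxx.
  under eq_bigr => P _ do rewrite (neg_mobius_upper n0 ymin psiP (erefl (psi P))).
  rewrite /partition_number /partition_sum.
  rewrite (reindex_omap (fun P : partition_lattice n => val P) insub) => [|P PP]; last first.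
    by rewrite insubT.
  by apply: eq_bigl => P; rewrite valK eqxx andbT (valP P).
rewrite sumr_const -[LHS]mulr_natl; congr (_%:R * _).
by rewrite /denom; case: (n) n0 => // m _; rewrite cardsE.
Qed.

End RestrictedMobius.

(** * Passage to generating functions *)

Theorem theorem4p1 (d : Order.disp_t) (Q : nat -> finPOrderType d)
    (hQ : exponential_structure Q)
    (I : set nat) (hI : forall i, I i -> (0 < i)%N) :
  let den (n : nat) : rat := (denom Q n * n`!)%:R in
  ((fun i => if i \in I then (mu_restricted Q I i)%:~R / den i else 0)
     : fps rat) =1
  fps_opp (fps_ln (fps_sub
    (fun n => 1 / den n)
    (fun n => if (0 < n)%N && (n \notin I)
              then (m_restricted Q I n)%:~R / den n else 0))).
Proof.
move=> den; set f := fps_sub _ _.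
have fE : f =1 (fun n => partition_number (weight Q I) n / n`!%:R).
  case=> [|n]; rewrite /f /fps_sub /=.
    by rewrite partition_number0 subr0 /den /denom /= mul1n.
  have EM := sum_neg_mobius_partitions hQ I (ltn0Sn n).
  have D0 := denom_neq0 hQ n.+1.
  have mE : (if n.+1 \notin I then (m_restricted Q I n.+1)%:~R / den n.+1 else 0)
      = (m_restricted Q I n.+1)%:~R / den n.+1.
    case: ifP => // /negbFE nI; have [t tt] := exists_top hQ (ltn0Sn n).
    have tI : in_restriction I t by rewrite (in_restriction_top hQ).
    rewrite m_restrictedE -(sum_neg_mobius_le tI) (eq_bigl xpredT) //.
    by rewrite subrr mul0r.
  rewrite mE -mulrBl m_restrictedE opprB addrC subrK EM /den natrM.
  by rewrite invfM mulrA [_ * partition_number _ _]mulrC mulfK.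
move=> i; rewrite /fps_opp (funext fE : f = _); case: i => [|i].
  (* Neither side has a constant term: 0 is not in [I] by [hI], and the logarithm is an empty
     sum. *)
  case: ifP => [/set_mem/hI//|_].
  by rewrite /fps_ln big_geq ?oppr0.
rewrite fps_ln_partition_number // /weight /den.
rewrite natrM invfM mulrA -!mulNr opprK; case: ifP => // iI.
by rewrite /mu_restricted iI !mul0r.
Qed.
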